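(* Let $a,b,c,d\ge 0$ and $a+c>0$. Let $X$ be the $(q,a,b,c,d)$-branco-process, let $\alpha:=\frac{a}{a+c}$, and let $\overline X$ be the $(q,0,(1+\alpha)b,a+c,\alpha b+d)$-branco-process (both with initial states a.s. in $\mathcal{E}_\gamma(\Lambda)$). Then $$\mathbb{P}[X_0\in\cdot\,]=\mathbb{P}\big[\mathrm{Thin}_{\frac{1}{1+\alpha}}(\overline X_0)\in\cdot\,\big]\quad\text{implies}\quad\mathbb{P}[X_t\in\cdot\,]=\mathbb{P}\big[\mathrm{Thin}_{\frac{1}{1+\alpha}}(\overline X_t)\in\cdot\,\big]\qquad(t\ge 0).$$
   Context: Lattice. $\Lambda$ is a finite or countably infinite set and $q(i,j)\ge 0$ ($i,j\in\Lambda$), with $q(i,i)=0$, are jump rates satisfying: (i) $\sup_i\sum_j q(i,j)<\infty$; (ii) for every $\Delta\subset\Lambda$ with $\Delta\neq\emptyset,\Lambda$ there exist $i\in\Delta$, $j\in\Lambda\setminus\Delta$ with $q(i,j)>0$ or $q(j,i)>0$; (iii) $\sum_j q^\dagger(i,j)=\sum_j q(i,j)$ for all $i$, where $q^\dagger(i,j):=q(j,i)$. Sums and suprema over $i,j$ run over $\Lambda$; $\mathbb{N}=\{0,1,2,\dots\}$; $|\phi|:=\sum_i|\phi(i)|$; $\delta_i(j):=1_{\{i=j\}}$. Fix strictly positive constants $\gamma=(\gamma_i)_{i\in\Lambda}$ with $\sum_i\gamma_i<\infty$ and $\sum_j(q(i,j)+q^\dagger(i,j))\gamma_j\le K\gamma_i$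 for all $i$ and some $K<\infty$. Set $\|x\|_\gamma:=\sum_i\gamma_i|x(i)|$ and $\mathcal{E}_\gamma(\Lambda):=\{x\in\mathbb{N}^\Lambda:\|x\|_\gamma<\infty\}$. Branco-process. For $a,b,c,d\ge 0$, the $(q,a,b,c,d)$-branco-process $X=(X_t)_{t\ge 0}$, where $X_t(i)$ is the number of particles at site $i$ at time $t$, is the Markov process in which: each particle jumps independently from $i$ to $j$ with rate $q(i,j)$; each pair of particles on the same site annihilates (both disappear) with rate $2a$; each particle splits into two on its site with rate $b$; each pair of particles on the same site coalesces into one with rate $2c$; each particle dies with rate $d$. Its formal generator is $$Gf(x)=\sum_{ij}q(i,j)x(i)\{f(x+\delta_j-\delta_i)-f(x)\}+a\sum_i x(i)(x(i)-1)\{f(x-2\delta_i)-f(x)\}+b\sum_i x(i)\{f(x+\delta_i)-f(x)\}+c\sum_i x(i)(x(i)-1)\{f(x-\delta_i)-f(x)\}+d\sum_i x(i)\{f(x-\delta_i)-f(x)\}.$$ From finite initial states ($|x|<\infty$) it is a nonexplosive continuous-time Markov chain. For $x\in\mathcal{E}_\gamma(\Lambda)$ it is the unique (in law) Markov process with cadlag paths in $(\mathcal{E}_\gamma(\Lambda),\|\cdot\|_\gamma)$ with $\mathbb{E}^x[f(X_t)]=S_tf(x)$ for all $\|\cdot\|_\gamma$-Lipschitz $f:\mathcal{E}_\gamma(\Lambda)\to\mathbb{R}$, where $S_tf$ is the unique Lipschitz extension to $\mathcal{E}_\gamma(\Lambda)$ of the function $x\mapsto\mathbb{E}^x[f(X_t)]$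 on finite states. Thinning. For a constant $p\in[0,1]$ and an $\mathbb{N}^\Lambda$-valued random variable $x$, $\mathrm{Thin}_p(x)$ is the $\mathbb{N}^\Lambda$-valued random variable obtained by keeping each particle of $x$ independently with probability $p$; its law is determined by $\mathbb{E}[(1-\psi)^{\mathrm{Thin}_p(x)}]=\mathbb{E}[(1-p\psi)^{x}]$ for $\psi\in[0,1]^\Lambda$, where $\phi^x:=\prod_i\phi(i)^{x(i)}$ with $0^0:=1$. *)

(* Defs.v *)
From HB Require Import structures.
From mathcomp Require Import all_boot all_order all_algebra.
From mathcomp Require Import all_classical all_reals all_analysis.

Set Implicit Arguments.
Unset Strict Implicit.
Unset Printing Implicit Defensive.

Import Order.TTheory GRing.Theory Num.Theory.
Import numFieldNormedType.Exports.

Local Open Scope classical_set_scope.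
Local Open Scope ring_scope.

(* Absolutely convergent sum of a real family over a (possibly infinite) set:
   sum of the positive parts minus sum of the negative parts. It is only
   meaningful when both parts have a finite sum. *)
Definition asum (R : realType) (I : choiceType) (D : set I) (f : I -> R) : R :=
  fine (\esum_(i in D) (Num.max (f i) 0)%:E)
  - fine (\esum_(i in D) (Num.max (- f i) 0)%:E).

Section lattice.
Context {R : realType} {L : countType}.
Implicit Types (q : L -> L -> R) (gamma : L -> R).

Definition jump_rates q : Prop :=
  [/\ (forall i j, 0 <= q i j),
      (forall i, q i i = 0),
      (ereal_sup [set \esum_(j in [set: L]) (q i j)%:E | i in [set: L]]
         < +oo)%E,
      (forall D : set L, D !=set0 -> D <> [set: L] ->
         exists i j, [/\ D i, ~ D j & 0 < q i j \/ 0 < q j i]) &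
      (forall i, \esum_(j in [set: L]) (q j i)%:E
                 = \esum_(j in [set: L]) (q i j)%:E)].

Definition site_weights q gamma : Prop :=
  [/\ (forall i, 0 < gamma i),
      (\esum_(i in [set: L]) (gamma i)%:E < +oo)%E &
      exists K : R, forall i,
        (\esum_(j in [set: L]) ((q i j + q j i) * gamma j)%:E
           <= (K * gamma i)%:E)%E].

Definition wnorm gamma (phi : L -> R) : \bar R :=
  \esum_(i in [set: L]) (gamma i * `|phi i|)%:E.

End lattice.

(* Particle configurations carry the product sigma-algebra, generated by the
   coordinates. On the configurations with finite gamma-norm it coincides with
   the Borel sigma-algebra of the gamma-norm, which is separable there. *)
Definition coordinate_events (L : countType) : set (set (L -> nat)) :=
  [set A | exists (i : L) (n : nat), A = [set x | x i = n]].

Definition config (L : countType) := g_sigma_algebraType (@coordinate_events L).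

Section branco.
Context {R : realType} {L : countType}.
Implicit Types (q : L -> L -> R) (gamma : L -> R) (f g : config L -> R).
Implicit Types (x y z : config L).

Definition particles x : L -> R := fun i => (x i)%:R.

Definition gdist gamma x y : \bar R :=
  wnorm gamma (fun i => particles x i - particles y i).

Definition Egamma gamma : set (config L) :=
  [set x | (wnorm gamma (particles x) < +oo)%E].

Definition fin_config : set (config L) :=
  [set x | (wnorm (cst 1%R : L -> R) (particles x) < +oo)%E].

Definition lipschitz_Egamma gamma f : Prop :=
  exists C : R, forall x y, Egamma gamma x -> Egamma gamma y ->
    ((`|f x - f y|)%:E <= C%:E * gdist gamma x y)%E.

(* Subtraction in nat is truncated, but the rates below vanish whenever a
   particle would be removed from a site that does not hold it. *)
Definition jump x (i j : L) : config L :=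
  fun k => (x k + (k == j) - (k == i))%N.
Definition remove x (n : nat) (i : L) : config L :=
  fun k => (x k - n * (k == i))%N.
Definition add1 x (i : L) : config L := fun k => (x k + (k == i))%N.

Definition branco_generator q (a b c d : R) f x : R :=
  asum [set: L * L]
    (fun ij => q ij.1 ij.2 * (x ij.1)%:R * (f (jump x ij.1 ij.2) - f x))
  + a * asum [set: L]
    (fun i => (x i)%:R * ((x i)%:R - 1) * (f (remove x 2 i) - f x))
  + b * asum [set: L] (fun i => (x i)%:R * (f (add1 x i) - f x))
  + c * asum [set: L]
    (fun i => (x i)%:R * ((x i)%:R - 1) * (f (remove x 1 i) - f x))
  + d * asum [set: L] (fun i => (x i)%:R * (f (remove x 1 i) - f x)).

(* [p t x y] are the transition probabilities of the nonexplosive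
   continuous-time Markov chain on finite configurations whose Q-matrix is
   Q(x,y) = G 1_{y} (x). Nonexplosion is expressed by total mass 1. *)
Definition branco_chain q (a b c d : R)
    (p : R -> config L -> config L -> R) : Prop :=
  [/\ (forall (t : R) x y, 0 <= t -> fin_config x -> fin_config y -> 0 <= p t x y),
      (forall (t : R) x, 0 <= t -> fin_config x ->
         \esum_(y in fin_config) (p t x y)%:E = 1%E),
      (forall x y, fin_config x -> fin_config y -> p 0 x y = \1_[set y] x),
      (forall (s t : R) x z, 0 <= s -> 0 <= t -> fin_config x -> fin_config z ->
         (p (s + t) x z)%:E
         = \esum_(y in fin_config) (p s x y * p t y z)%:E) &
      (forall x y, fin_config x -> fin_config y ->
         (p h x y - p 0 x y) / h @[h --> 0^'+]
           --> branco_generator q a b c d \1_[set y] x)].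

(* [g] is the function S_t f: the Lipschitz extension to finite gamma-norm of
   x |-> E^x[f(X_t)] on finite configurations. *)
Definition lipschitz_extension gamma (p : R -> config L -> config L -> R)
    (t : R) f g : Prop :=
  lipschitz_Egamma gamma g /\
  (forall x, fin_config x -> g x = asum fin_config (fun y => p t x y * f y)).

(* The values of the kernels outside [Egamma gamma] are irrelevant. *)
Definition branco_kernel q gamma (a b c d : R)
    (k : R -> R.-pker config L ~> config L) : Prop :=
  exists2 p, branco_chain q a b c d p &
    forall t : R, 0 <= t ->
      (forall x, Egamma gamma x -> k t x (Egamma gamma) = 1%E) /\
      (forall f, lipschitz_Egamma gamma f ->
         exists2 g, lipschitz_extension gamma p t f g &
           forall x, Egamma gamma x ->
             (k t x).-integrable (Egamma gamma) (EFin \o f) /\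
             (\int[k t x]_(y in Egamma gamma) (f y)%:E = (g x)%:E)%E).

Definition cadlag_in_Egamma gamma (w : R -> config L) : Prop :=
  [/\ (forall t : R, 0 <= t -> Egamma gamma (w t)),
      (forall t : R, 0 <= t -> gdist gamma (w s) (w t) @[s --> t^'+] --> 0%E) &
      (forall t : R, 0 < t -> exists2 y, Egamma gamma y &
         gdist gamma (w s) y @[s --> t^'-] --> 0%E)].

Section process.
Context {dO : measure_display} {Omega : measurableType dO}.
Variable P : probability Omega R.

Definition past (X : R -> {RV P >-> config L}) (s : R) : set (set Omega) :=
  <<s [set A | exists (u : R) (B : set (config L)),
         [/\ 0 <= u <= s, measurable B & A = X u @^-1` B]] >>.

Definition markov_process (k : R -> R.-pker config L ~> config L)
    (X : R -> {RV P >-> config L}) : Prop :=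
  forall (s t : R) A B, 0 <= s -> 0 <= t -> past X s A -> measurable B ->
    P (A `&` X (s + t) @^-1` B) = (\int[P]_(w in A) k t (X s w) B)%E.

(* Only the times t >= 0 matter. *)
Definition branco_process q gamma (a b c d : R)
    (X : R -> {RV P >-> config L}) : Prop :=
  {ae P, forall w, cadlag_in_Egamma gamma (fun t => X t w)} /\
  exists2 k, branco_kernel q gamma a b c d k & markov_process k X.

End process.
End branco.

Definition same_law d1 d2 d' (O1 : measurableType d1) (O2 : measurableType d2)
    (T : measurableType d') (R : realType)
    (P1 : probability O1 R) (X1 : {RV P1 >-> T})
    (P2 : probability O2 R) (X2 : {RV P2 >-> T}) : Prop :=
  forall A, measurable A -> distribution P1 X1 A = distribution P2 X2 A.

(* [Z], defined on some probability space, is a version of Thin_r(Y): that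
   space carries a copy [Y'] of [Y] and marks [keep i n] telling whether the
   n-th particle at site i is kept; the marks are Bernoulli(r), independent of
   each other and of [Y']. *)
Definition is_thinning (R : realType) (L : countType) dO dS
    (O : measurableType dO) (S : measurableType dS) (r : R)
    (P : probability O R) (Y : {RV P >-> config L})
    (Q : probability S R) (Z : {RV Q >-> config L}) : Prop :=
  exists (Y' : {RV Q >-> config L}) (keep : L -> nat -> {RV Q >-> bool}),
  [/\ same_law Y' Y,
      (forall (B : set (config L)) (J : seq (L * nat)) (e : L * nat -> bool),
         measurable B -> uniq J ->
         Q (Y' @^-1` B `&` [set w | forall m, m \in J -> keep m.1 m.2 w = e m])
         = (Q (Y' @^-1` B)
            * (\prod_(m <- J) (if e m then r else 1 - r))%:E)%E) &
      (forall w i, Z w i = (\sum_(n < Y' w i) keep i n w)%N)].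

(* Main.v *)
Require Import Defs.
From HB Require Import structures.
From mathcomp Require Import all_boot all_order all_algebra.
From mathcomp Require Import all_classical all_reals all_analysis.
From mathcomp Require Import ring lra measurable_realfun.

Set Implicit Arguments.
Unset Strict Implicit.
Unset Printing Implicit Defensive.

Import Order.TTheory GRing.Theory Num.Theory.
Import numFieldNormedType.Exports.

Local Open Scope classical_set_scope.
Local Open Scope ring_scope.

(* Let K average a function over an independent thinning with retention
   probability r = 1 / (1 + alpha), and write D_i f(x) = x(i) f(x - delta_i)
   and T_i f(x) = f(x + delta_i). Then T_i K = K ((1 - r) + r T_i) and
   K D_i = r D_i K; both generators G and Gbar are polynomials in the D_i and
   T_i, and these relations give Gbar K = K G. Hence K P_t f and Pbar_t K f
   both solve the backward equation of Gbar with initial value K f. Bounded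
   solutions are unique because the number of particles is a Lyapunov function,
   so Pbar_t K = K P_t on finite configurations. For infinite configurations,
   restrict the initial states to finitely many sites: cylinder functions are
   Lipschitz, so the Lipschitz extensions of P_t f and Pbar_t K f are the limits
   along these restrictions, and cylinder events determine the law. *)

(** * Absolutely convergent sums *)

(** The value of [alpha] is forced. Since 1/r = 1 + alpha, moving [K] to the right past T replaces T
    by T' = (1 + alpha) T - alpha, and 1 - T' = (1 + alpha)(1 - T). The pair part a D^2 (1 - T^2) +
    c D^2 (T - T^2) of G becomes r D^2 (1 - T) (a - alpha (a + c) + (1 + alpha)(a + c) T):
    annihilation disappears exactly when alpha = a / (a + c), and coalescence with parameter a + c
    remains. Branching b D (T^2 - T) turns into branching (1 + alpha) b plus death alpha b. The
    analytic obstacle is that a chain supplies only the right derivative at time 0 of each single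
    entry of p, while a particle may have infinitely many jump targets and pair rates grow
    quadratically. So P_h f = f + h G f + o(h) is proved at each configuration with an error uniform
    over all f with values in [0, 1]. The semigroup property turns this into uniformity in t, and
    uniqueness follows from an Euler scheme with one-sided steps. *)

Section asum_theory.
Context {R : realType} {I : choiceType}.
Implicit Types (D : set I) (f g : I -> R).

Definition abs_summable D f : Prop :=
  (\esum_(i in D) `|f i|%:E < +oo)%E.

Lemma esum_ge0_fin_num D g : (forall i, D i -> 0 <= g i) ->
  (\esum_(i in D) (g i)%:E < +oo)%E -> \esum_(i in D) (g i)%:E \is a fin_num.
Proof.
move=> g0 gD; rewrite ge0_fin_numE//.
by apply: esum_ge0 => i Di; rewrite lee_fin g0.
Qed.

Lemma ge0_abs_summable D f : (forall i, D i -> 0 <= f i) ->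
  (\esum_(i in D) (f i)%:E < +oo)%E -> abs_summable D f.
Proof.
move=> f0; rewrite /abs_summable; congr (_ < _)%E.
by apply: eq_esum => i Di; rewrite ger0_norm// f0.
Qed.

Lemma abs_summable_ge0 D f : (forall i, D i -> 0 <= f i) ->
  abs_summable D f -> (\esum_(i in D) (f i)%:E < +oo)%E.
Proof.
move=> f0; rewrite /abs_summable; congr (_ < _)%E.
by apply: eq_esum => i Di; rewrite ger0_norm// f0.
Qed.

Lemma le_abs_summable D f g : (forall i, D i -> `|f i| <= `|g i|) ->
  abs_summable D g -> abs_summable D f.
Proof.
move=> fg; apply: le_lt_trans; apply: le_esum => i Di.
by rewrite lee_fin fg.
Qed.

Lemma eq_asum D f g : (forall i, D i -> f i = g i) -> asum D f = asum D g.
Proof.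
by move=> fg; rewrite /asum; congr (fine _ - fine _); apply: eq_esum => i Di;
  rewrite fg.
Qed.

(** Positive parts are not additive, so linearity cannot be read off the definition of [asum]. Any
    splitting into nonnegative summable families serves equally well, because f^+ + h = f^- + g
    pointwise and sums of nonnegative families add. *)
Lemma asum_posneg D f g h : (forall i, D i -> 0 <= g i) ->
  (forall i, D i -> 0 <= h i) ->
  (\esum_(i in D) (g i)%:E < +oo)%E -> (\esum_(i in D) (h i)%:E < +oo)%E ->
  (forall i, D i -> f i = g i - h i) ->
  asum D f = fine (\esum_(i in D) (g i)%:E) - fine (\esum_(i in D) (h i)%:E).
Proof.
move=> g0 h0 gD hD fE.
have pf : \esum_(i in D) (Num.max (f i) 0)%:E \is a fin_num.
  apply: esum_ge0_fin_num => [i _|]; first by rewrite le_max lexx orbT.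
  apply: le_lt_trans gD; apply: le_esum => i Di; rewrite lee_fin ge_max g0//.
  by rewrite fE// lerBlDr lerDl h0.
have nf : \esum_(i in D) (Num.max (- f i) 0)%:E \is a fin_num.
  apply: esum_ge0_fin_num => [i _|]; first by rewrite le_max lexx orbT.
  apply: le_lt_trans hD; apply: le_esum => i Di; rewrite lee_fin ge_max h0//.
  by rewrite fE// opprB lerBlDr lerDl g0.
have gf := esum_ge0_fin_num g0 gD; have hf := esum_ge0_fin_num h0 hD.
have E u v u' v' : u + v' = u' + v :> R -> u - v = u' - v' by move=> ?; lra.
rewrite /asum; apply: E; rewrite -!fineD//; congr fine.
rewrite -!esumD//; try by move=> i Di; rewrite lee_fin ?g0 ?h0// le_max lexx orbT.
apply: eq_esum => i Di; rewrite -!EFinD; congr EFin; rewrite fE//.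
by have := g0 _ Di; have := h0 _ Di; case: (leP (g i - h i) 0);
 case: (leP (- (g i - h i)) 0); lra.
Qed.

Lemma ge0_asumE D f : (forall i, D i -> 0 <= f i) ->
  (\esum_(i in D) (f i)%:E < +oo)%E -> (asum D f)%:E = \esum_(i in D) (f i)%:E.
Proof.
move=> f0 fD; rewrite (@asum_posneg D f f (cst 0))//.
- by rewrite [X in _ - fine X]esum1// subr0 fineK// esum_ge0_fin_num.
- by rewrite esum1.
- by move=> i _; rewrite subr0.
Qed.

Lemma abs_summable_posneg D f : abs_summable D f -> exists g h : I -> R,
  [/\ forall i, D i -> 0 <= g i, forall i, D i -> 0 <= h i,
      (\esum_(i in D) (g i)%:E < +oo)%E, (\esum_(i in D) (h i)%:E < +oo)%E &
      forall i, D i -> f i = g i - h i].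
Proof.
move=> fD; exists (fun i => Num.max (f i) 0), (fun i => Num.max (- f i) 0).
split=> [i _|i _|||i _]; rewrite ?le_max ?lexx ?orbT//.
- apply: le_lt_trans fD; apply: le_esum => i Di; rewrite lee_fin.
  by rewrite ge_max normr_ge0 ler_norm.
- apply: le_lt_trans fD; apply: le_esum => i Di; rewrite lee_fin.
  by rewrite ge_max normr_ge0 -normrN ler_norm.
- by case: (leP (f i) 0); case: (leP (- f i) 0); lra.
Qed.

Lemma abs_summableD D f g : abs_summable D f -> abs_summable D g ->
  abs_summable D (fun i => f i + g i).
Proof.
move=> fD gD; apply: le_lt_trans (lte_add_pinfty fD gD).
rewrite -esumD; [|by move=> *; rewrite lee_fin..].
by apply: le_esum => i Di; rewrite -EFinD lee_fin ler_normD.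
Qed.

Lemma esumZ D (k : R) f : 0 <= k ->
  \esum_(i in D) (k * f i)%:E = (k%:E * \esum_(i in D) (f i)%:E)%E.
Proof.
move=> k0; rewrite /esum -ereal_supZl//; last first.
  by apply/set0P; exists 0%E; exists set0; [exact: fsets_set0|rewrite fsbig_set0].
have kE A : finite_set A -> (\sum_(x \in A) (k * f x)%:E)%E =
    (k%:E * \sum_(x \in A) (f x)%:E)%E.
  by move=> finA; rewrite !fsbig_finite// !sumEFin -EFinM mulr_sumr.
congr ereal_sup; apply/seteqP; split => [_ [A [finA AD] <-]|].
  by exists (\sum_(x \in A) (f x)%:E)%E; [exists A|rewrite kE].
by move=> _ [_ [A [finA AD] <-] <-]; exists A; rewrite ?kE.
Qed.

Lemma asumD D f g : abs_summable D f -> abs_summable D g ->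
  asum D (fun i => f i + g i) = asum D f + asum D g.
Proof.
move=> /abs_summable_posneg[f1 [f2 [f10 f20 f1D f2D fE]]].
move=> /abs_summable_posneg[g1 [g2 [g10 g20 g1D g2D gE]]].
rewrite (asum_posneg f10 f20 f1D f2D fE) (asum_posneg g10 g20 g1D g2D gE).
have pE : (\esum_(i in D) (f1 i + g1 i)%:E =
   \esum_(i in D) (f1 i)%:E + \esum_(i in D) (g1 i)%:E)%E.
  by rewrite -esumD// => i Di; rewrite lee_fin ?f10 ?g10.
have nE : (\esum_(i in D) (f2 i + g2 i)%:E =
   \esum_(i in D) (f2 i)%:E + \esum_(i in D) (g2 i)%:E)%E.
  by rewrite -esumD// => i Di; rewrite lee_fin ?f20 ?g20.
rewrite (@asum_posneg D _ (fun i => f1 i + g1 i) (fun i => f2 i + g2 i)).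
- rewrite pE nE !fineD ?esum_ge0_fin_num//.
  by rewrite opprD addrACA.
- by move=> i Di; rewrite addr_ge0 ?f10 ?g10.
- by move=> i Di; rewrite addr_ge0 ?f20 ?g20.
- by rewrite pE lte_add_pinfty.
- by rewrite nE lte_add_pinfty.
- by move=> i Di; rewrite fE// gE// opprD addrACA.
Qed.

Lemma abs_summableZ D k f : abs_summable D f ->
  abs_summable D (fun i => k * f i).
Proof.
move=> fD; rewrite /abs_summable; under eq_esum do rewrite normrM.
rewrite esumZ// lte_mul_pinfty//.
Qed.

Lemma asumZ D k f : abs_summable D f -> asum D (fun i => k * f i) = k * asum D f.
Proof.
move=> fD.
have pE l g : 0 <= l -> fine (\esum_(i in D) (l * g i)%:E) =
    l * fine (\esum_(i in D) (g i)%:E).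
  move=> l0; rewrite esumZ//.
  have [->|l0'] := eqVneq l 0; first by rewrite mul0e mul0r.
  case: (\esum_(i in D) (g i)%:E) => [r//| |].
    by rewrite gt0_muley ?mulr0// lte_fin lt_neqAle eq_sym l0'.
  by rewrite gt0_muleNy ?mulr0// lte_fin lt_neqAle eq_sym l0'.
have fin l g : (\esum_(i in D) (g i)%:E < +oo)%E -> 0 <= l ->
    (forall i, D i -> 0 <= g i) -> (\esum_(i in D) (l * g i)%:E < +oo)%E.
  move=> gD l0 g0; rewrite esumZ// lte_mul_pinfty ?lee_fin//.
have [f1 [f2 [f10 f20 f1D f2D fE]]] := abs_summable_posneg fD.
rewrite (asum_posneg f10 f20 f1D f2D fE).
have [k0|k0] := leP 0 k.
  rewrite (@asum_posneg D _ (fun i => k * f1 i) (fun i => k * f2 i)).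
  - by rewrite (pE k f1 k0) (pE k f2 k0) mulrBr.
  - by move=> i Di; rewrite mulr_ge0// f10.
  - by move=> i Di; rewrite mulr_ge0// f20.
  - exact: fin.
  - exact: fin.
  - by move=> i Di; rewrite -mulrBr fE.
(* A negative factor exchanges the roles of the two parts. *)
have k0' : 0 <= - k by rewrite oppr_ge0 ltW.
rewrite (@asum_posneg D _ (fun i => - k * f2 i) (fun i => - k * f1 i)).
- by rewrite (pE _ f1 k0') (pE _ f2 k0') mulrBr !mulNr opprK addrC.
- by move=> i Di; rewrite mulr_ge0// f20.
- by move=> i Di; rewrite mulr_ge0// f10.
- exact: fin.
- exact: fin.
- by move=> i Di; rewrite fE// mulrBr !mulNr opprK addrC.
Qed.

Lemma asumB D f g : abs_summable D f -> abs_summable D g ->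
  asum D (fun i => f i - g i) = asum D f - asum D g.
Proof.
move=> fD gD; transitivity (asum D (fun i => f i + (-1) * g i)).
  by apply: eq_asum => i _; rewrite mulN1r.
by rewrite asumD ?asumZ ?mulN1r//; exact: abs_summableZ.
Qed.

Lemma asum_ge0 D f : (forall i, D i -> 0 <= f i) -> 0 <= asum D f.
Proof.
move=> f0; rewrite /asum.
rewrite [X in fine _ - fine X]esum1 ?subr0//; last first.
  by move=> i Di; rewrite max_r// oppr_le0 f0.
by apply/fine_ge0/esum_ge0 => i _; rewrite lee_fin le_max lexx orbT.
Qed.

Lemma le_asum D f g : abs_summable D f -> abs_summable D g ->
  (forall i, D i -> f i <= g i) -> asum D f <= asum D g.
Proof.
move=> fD gD fg; rewrite -subr_ge0 -asumB//; apply: asum_ge0 => i Di.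
by rewrite subr_ge0 fg.
Qed.

Lemma asum0 D f : (forall i, D i -> f i = 0) -> asum D f = 0.
Proof.
move=> f0; rewrite /asum !esum1 ?subr0// => i Di; rewrite f0// ?oppr0 maxxx//.
Qed.

Lemma abs_summable0 D f : (forall i, D i -> f i = 0) -> abs_summable D f.
Proof.
by move=> f0; rewrite /abs_summable esum1// => i Di; rewrite f0// normr0.
Qed.

Lemma abs_summable_sum D (J : Type) (s : seq J) (F : J -> I -> R) :
  (forall j, abs_summable D (F j)) ->
  abs_summable D (fun i => \sum_(j <- s) F j i).
Proof.
move=> FD; elim: s => [|j s ih].
  by apply: abs_summable0 => i _; rewrite big_nil.
under eq_fun do rewrite big_cons; exact: abs_summableD.
Qed.

Lemma asum_sum D (J : Type) (s : seq J) (F : J -> I -> R) :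
  (forall j, abs_summable D (F j)) ->
  asum D (fun i => \sum_(j <- s) F j i) = \sum_(j <- s) asum D (F j).
Proof.
move=> FD; elim: s => [|j s ih].
  by rewrite big_nil; apply: asum0 => i _; rewrite big_nil.
rewrite big_cons; under eq_fun do rewrite big_cons.
by rewrite asumD ?ih//; exact: abs_summable_sum.
Qed.

Lemma esum_pred1 D j : \esum_(i in D) ((i == j)%:R : R)%:E = (j \in D)%:R%:E.
Proof.
rewrite esum_mkcond.
rewrite (eq_esum (b := fun i => if i \in [set j] then (j \in D)%:R%:E else 0%E)).
  by rewrite -esum_mkcond esum_set1// lee_fin.
move=> i _; have [->|ij] := eqVneq i j.
  by rewrite (@mem_set _ [set j] j)//; case: (j \in D).
by rewrite if_same (@memNset _ [set j] i)// => /eqP; rewrite (negPf ij).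
Qed.

Lemma abs_summable_finite D f (s : seq I) :
  (forall i, D i -> i \notin s -> f i = 0) -> abs_summable D f.
Proof.
move=> fs; apply: (@le_abs_summable _ _ (fun i => \sum_(j <- s) `|f j| * (i == j)%:R)).
  move=> i Di; have [si|/(fs _ Di)->] := boolP (i \in s); last by rewrite normr0.
  apply: le_trans (ler_norm _).
  rewrite (big_rem i)//= eqxx mulr1 lerDl; apply: sumr_ge0 => j _.
  exact: mulr_ge0.
apply: abs_summable_sum => j; apply: abs_summableZ.
rewrite /abs_summable; under eq_esum do rewrite normr_nat.
by rewrite esum_pred1 ltry.
Qed.

Lemma asum_finite D f (s : seq I) : uniq s -> (forall i, i \in s -> D i) ->
  (forall i, D i -> i \notin s -> f i = 0) ->
  asum D f = \sum_(i <- s) f i.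
Proof.
elim: s f => [|j s ih] f /=.
  by move=> _ _ f0; rewrite big_nil; apply: asum0 => i /f0; apply.
move=> /andP[js us] sD fs; rewrite big_cons.
pose g i := f j * (i == j)%:R; pose h i := f i * (i != j)%:R.
have gs : abs_summable D g.
  apply: (@abs_summable_finite _ _ [:: j]) => i _; rewrite inE /g => /negPf->.
  by rewrite mulr0.
have hs i : D i -> i \notin s -> h i = 0.
  move=> Di si; rewrite /h; have [ij|ij] := eqVneq i j; first by rewrite mulr0.
  by rewrite mulr1; apply: fs => //; rewrite inE negb_or ij.
rewrite (@eq_asum _ _ (fun i => g i + h i)); last first.
  by move=> i Di; rewrite /g /h; case: eqVneq => [->|] /=; rewrite mulr0 mulr1 ?addr0 ?add0r.
rewrite asumD//; last exact: abs_summable_finite hs.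
have sD' i : i \in s -> D i by move=> si; apply: sD; rewrite inE si orbT.
rewrite (ih h us sD' hs).
congr (_ + _).
  have gE : \esum_(i in D) ((i == j)%:R : R)%:E = 1%:E.
    have Dj : D j by apply: sD; rewrite inE eqxx.
    by rewrite esum_pred1 (mem_set Dj).
  rewrite /g asumZ; last by apply: ge0_abs_summable; rewrite // gE ltry.
  rewrite -[RHS]mulr1; congr (_ * _); apply: EFin_inj.
  by rewrite ge0_asumE// gE ltry.
rewrite big_seq [RHS]big_seq; apply: eq_bigr => i si; rewrite /h.
by case: eqVneq si js => [->->|]//; rewrite mulr1.
Qed.

Lemma ge0_asum_ge_finite D f (s : seq I) : uniq s -> (forall i, i \in s -> D i) ->
  (forall i, D i -> 0 <= f i) -> abs_summable D f ->
  \sum_(i <- s) f i <= asum D f.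
Proof.
move=> us sD f0 fD.
have E : asum D (fun i => f i * (i \in s)%:R) = \sum_(i <- s) f i.
  rewrite (@asum_finite _ _ s)//; last by move=> i _ /negPf->; rewrite mulr0.
  by rewrite big_seq [RHS]big_seq; apply: eq_bigr => i ->; rewrite mulr1.
rewrite -E; apply: le_asum => //.
  apply: le_abs_summable fD => i Di.
  by case: (i \in s); rewrite ?mulr1// mulr0 normr0.
by move=> i Di; case: (i \in s); rewrite ?mulr1// mulr0; exact: f0.
Qed.

(** The source of all finite truncations below: finite support of finite configurations, finitely
    many relevant jump targets, and restriction of an infinite configuration to finitely many
    sites. *)
Lemma abs_summable_tail D f (e : R) : (forall i, D i -> 0 <= f i) -> abs_summable D f ->
  0 < e -> exists s : seq I, asum D (fun i => f i * (i \notin s)%:R) < e.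
Proof.
move=> f0 fD e0.
have fD' := abs_summable_ge0 f0 fD.
have ffin := esum_ge0_fin_num f0 fD'.
have [_ [A [finA AD] <-] lt] := ub_ereal_sup_adherent e0 ffin.
pose s : seq I := finmap.enum_fset (fset_set A).
have us : uniq s by exact: finmap.fset_uniq.
have sE i : (i \in s) = (i \in A) by exact: in_fset_set.
exists s.
have E : asum D (fun i => f i * (i \in s)%:R) = \sum_(i <- s) f i.
  rewrite (@asum_finite _ _ s)//.
  - by rewrite big_seq [RHS]big_seq; apply: eq_bigr => i ->; rewrite mulr1.
  - by move=> i; rewrite sE inE => /AD.
  - by move=> i _ /negPf->; rewrite mulr0.
have le1 (P : pred I) : abs_summable D (fun i => f i * (P i)%:R).
  apply: le_abs_summable fD => i Di.
  by case: (P i); rewrite ?mulr1// mulr0 normr0.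
have : asum D f = asum D (fun i => f i * (i \in s)%:R) +
    asum D (fun i => f i * (i \notin s)%:R).
  rewrite -asumD; [|exact: (le1 (mem s))|exact: (le1 (fun i => i \notin s))].
  by apply: eq_asum => i _; case: (i \in s); rewrite /= mulr0 mulr1 ?addr0 ?add0r.
have {lt} : (\esum_(i in D) (f i)%:E - e%:E < (\sum_(i <- s) f i)%:E)%E.
  by move: lt; rewrite fsbig_finite//= sumEFin.
rewrite -(ge0_asumE f0 fD') -EFinB lte_fin E => lt fE; lra.
Qed.

End asum_theory.

(** * Finite configurations and their thinning *)
Section finite_configurations.
Context {L : countType}.
Implicit Types (s : seq L) (x : config L) (i j k : L).

(** A finite configuration is presented by the list of the positions of its particles, so that
    thinning can be defined by recursion over particles; the order of the list is immaterial. *)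
Definition cfg s : config L := fun k => count_mem k s.

Lemma cfg_perm s s' : perm_eq s s' -> cfg s = cfg s'.
Proof. by move=> /permP ss'; apply/funext => k; exact: ss'. Qed.

Lemma cfg_inj_perm s s' : cfg s = cfg s' -> perm_eq s s'.
Proof.
move=> ss'; apply/allP => k _ /=; apply/eqP.
exact: (congr1 (fun f : config L => f k) ss').
Qed.

Lemma add1_cfg s i : add1 (cfg s) i = cfg (i :: s).
Proof. by apply/funext => k; rewrite /add1 /cfg /= addnC eq_sym. Qed.

Lemma count_mem_rem s i k : count_mem k (rem i s) = (count_mem k s - (k == i))%N.
Proof.
have [si|si] := boolP (i \in s).
  have /permP -> := perm_to_rem si; rewrite /= eq_sym.
  by case: eqVneq => _; rewrite /= ?add1n ?subn1//= add0n subn0.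
rewrite rem_id//; case: eqVneq => [->|_]; last by rewrite subn0.
by have /count_memPn-> := si.
Qed.

Lemma remove1_cfg s i : remove (cfg s) 1 i = cfg (rem i s).
Proof.
by apply/funext => k; rewrite /remove /cfg mul1n count_mem_rem.
Qed.

Lemma remove2_cfg s i : remove (cfg s) 2 i = cfg (rem i (rem i s)).
Proof.
apply/funext => k; rewrite /remove /cfg !count_mem_rem -subnDA.
by rewrite addnn mul2n.
Qed.

Lemma cfg_head s i : cfg (i :: s) i = (cfg s i).+1.
Proof. by rewrite /cfg /= eqxx. Qed.

Lemma remove1_head s i : remove (cfg (i :: s)) 1 i = cfg s.
Proof. by rewrite remove1_cfg /= eqxx. Qed.

Lemma remove2_head s i : remove (cfg (i :: s)) 2 i = cfg (rem i s).
Proof. by rewrite remove2_cfg /= eqxx. Qed.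

Lemma jump_cfg s i j : i \in s -> jump (cfg s) i j = cfg (j :: rem i s).
Proof.
move=> si; apply/funext => k; rewrite /jump /cfg /= count_mem_rem (eq_sym j k).
have [->|ki] := eqVneq k i; last by rewrite !subn0 addnC.
have : (0 < count_mem i s)%N by rewrite -has_count has_pred1.
by case: (count_mem i s) => // n _; rewrite addSn !subn1 /= addnC.
Qed.

(** Here [x] may be infinite: for duplicate-free [D], [cfg] of this list is the restriction of [x]
    to the sites in [D]. *)
Definition particle_list (D : seq L) x : seq L :=
  flatten [seq nseq (x i) i | i <- D].

Lemma count_particle_list D x k : uniq D ->
  count_mem k (particle_list D x) = if k \in D then x k else 0%N.
Proof.
elim: D => [//|i D ih] /= /andP[iD uD]; rewrite /particle_list /= count_cat.
rewrite -/(particle_list D x) ih// inE count_nseq /= (eq_sym k).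
have [<-|ik] := eqVneq i k; first by rewrite (negPf iD) mul1n addn0.
by rewrite mul0n.
Qed.

Lemma fin_configP {R : realType} x :
  @fin_config R L x <-> exists s, x = cfg s.
Proof.
split=> [xfin|[s ->]].
  (* Occupation numbers are integers, so a tail sum smaller than 1 has only zero terms. *)
  pose f i : R := (x i)%:R.
  have f0 (i : L) : [set: L] i -> 0 <= f i by [].
  have fD : abs_summable [set: L] f.
    apply: le_lt_trans xfin; apply: le_esum => i _.
    by rewrite /cst mul1r /particles.
  have [s hs] := abs_summable_tail f0 fD ltr01.
  exists (particle_list (undup s) x); apply/funext => k.
  rewrite /cfg count_particle_list ?undup_uniq// mem_undup.
  case: ifPn => // ks; have gD : abs_summable [set: L] (fun i => f i * (i \notin s)%:R).
    apply: le_abs_summable fD => i _.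
    by case: (i \notin s); rewrite ?mulr1// mulr0 normr0.
  have := @ge0_asum_ge_finite _ _ _ _ [:: k] isT (fun _ _ => I)
    (fun i _ => mulr_ge0 (f0 i I) (ler0n R (i \notin s))) gD.
  rewrite big_seq1 ks mulr1 => /le_lt_trans/(_ hs).
  by rewrite /f ltrn1; case: (x k).
rewrite /fin_config /= /wnorm.
have : abs_summable [set: L] (fun i => (cfg s i)%:R : R).
  apply: (@abs_summable_finite _ _ _ _ s) => i _ /count_memPn.
  by rewrite /cfg => ->.
by apply: le_lt_trans; apply: le_esum => i _; rewrite /cst mul1r /particles.
Qed.

End finite_configurations.

(** * The thinning operator on finite configurations *)

Section thinning_operator.
Context {R : realType} {L : countType}.
Implicit Types (s : seq L) (f g : config L -> R) (i j k : L).
Variable r : R.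

(* The expectation of [f] after keeping each particle of [s] independently
   with probability [r]. *)
Fixpoint thin_op f s : R :=
  if s is i :: s' then
    (1 - r) * thin_op f s' + r * thin_op (fun x => f (add1 x i)) s'
  else f (cfg [::]).

Lemma eq_thin_op f g s : (forall s, f (cfg s) = g (cfg s)) ->
  thin_op f s = thin_op g s.
Proof.
elim: s f g => [|i s ih] f g fg /=; first exact: fg.
by rewrite (ih _ _ fg) (ih (fun x => f (add1 x i)) (fun x => g (add1 x i)))// => s';
  rewrite add1_cfg.
Qed.

Lemma thin_opD f g s : thin_op (fun x => f x + g x) s = thin_op f s + thin_op g s.
Proof. by elim: s f g => [//|i s ih] f g /=; rewrite !ih; ring. Qed.

Lemma thin_opZ (c : R) f s : thin_op (fun x => c * f x) s = c * thin_op f s.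
Proof. by elim: s f => [//|i s ih] f /=; rewrite !ih; ring. Qed.

Lemma thin_opB f g s : thin_op (fun x => f x - g x) s = thin_op f s - thin_op g s.
Proof. by elim: s f g => [//|i s ih] f g /=; rewrite !ih; ring. Qed.

Lemma thin_op_cst (c : R) s : thin_op (fun=> c) s = c.
Proof. by elim: s => [//|i s ih] /=; rewrite !ih; ring. Qed.

Lemma add1C (x : config L) i j : add1 (add1 x i) j = add1 (add1 x j) i.
Proof. by apply/funext => k; rewrite /add1 -!addnA (addnC (k == i)). Qed.

Lemma thin_op_swap f i s1 s2 :
  thin_op f (s1 ++ i :: s2) = thin_op f (i :: s1 ++ s2).
Proof.
elim: s1 f => [//|j s1 ih] f /=; rewrite !ih /=.
have -> : (fun x => f (add1 (add1 x i) j)) = (fun x => f (add1 (add1 x j) i)).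
  by apply/funext => x; rewrite add1C.
ring.
Qed.

(** The recursion treats particles one by one; independence of their order makes thinning a function
    of the configuration alone. *)
Lemma thin_op_perm f s s' : perm_eq s s' -> thin_op f s = thin_op f s'.
Proof.
elim: s f s' => [|i s ih] f s' ss'.
  by move: (perm_size ss'); case: s' {ss'}.
have is' : i \in s' by rewrite -(perm_mem ss') mem_head.
move: ss'; case/splitPr: is' => s1 s2 ss'.
have ss12 : perm_eq s (s1 ++ s2).
  by rewrite -(perm_cons i) (perm_trans ss')// perm_catC /= perm_cons perm_catC.
by rewrite thin_op_swap /= !(ih _ _ ss12).
Qed.

(** [thin_op] is a finite combination of evaluations at subconfigurations, so it passes through
    absolutely convergent sums. Summability is required at every list because the recursion shifts
    the argument. *)
Lemma thin_op_asum (I : choiceType) (D : set I) (F : I -> config L -> R) s :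
  (forall s, abs_summable D (fun e => F e (cfg s))) ->
  abs_summable D (fun e => thin_op (F e) s) /\
  thin_op (fun x => asum D (fun e => F e x)) s = asum D (fun e => thin_op (F e) s).
Proof.
elim: s F => [|i s ih] F FD /=; first by split; [exact: FD|].
have [S1 ->] := ih _ FD.
have [|S2 ->] := ih (fun e x => F e (add1 x i)).
  by move=> s'; rewrite add1_cfg.
split; first by apply: abs_summableD; exact: abs_summableZ.
by rewrite asumD ?asumZ//; exact: abs_summableZ.
Qed.

Lemma le_thin_op f g s : 0 <= r <= 1 -> (forall s, f (cfg s) <= g (cfg s)) ->
  thin_op f s <= thin_op g s.
Proof.
move=> /andP[r0 r1]; elim: s f g => [|i s ih] f g fg /=; first exact: fg.
apply: lerD; apply: ler_wpM2l; rewrite ?subr_ge0//; apply: ih => // s'.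
by rewrite add1_cfg.
Qed.

(** A particle that [f] does not see contributes the factor (1 - r) + r = 1. *)
Lemma thin_op_cfg f (D : {pred L}) s :
  (forall i s, i \notin D -> f (cfg (i :: s)) = f (cfg s)) ->
  thin_op f s = thin_op f [seq i <- s | i \in D].
Proof.
elim: s f => [//|i s ih] f fD /=; case: ifPn => iD /=.
  rewrite -!ih// => j s' jD; rewrite !add1_cfg.
  rewrite (@cfg_perm _ [:: i, j & s'] [:: j, i & s']) ?(fD j _ jD)//.
  by apply/permP => p /=; rewrite addnCA.
rewrite -!ih// (@eq_thin_op (fun x => f (add1 x i)) f) => [|s'].
  by ring.
by rewrite add1_cfg fD.
Qed.

(** This is the operator [K]. The list chosen by [xget] does not matter on finite configurations; on
    the others the empty list is a mere default. *)
Definition thin_fun f (x : config L) : R :=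
  thin_op f (xget [::] [set s | x = cfg s]).

Lemma thin_fun_cfg f s : thin_fun f (cfg s) = thin_op f s.
Proof.
rewrite /thin_fun; case: xgetP => [s' _ /cfg_inj_perm ss'|/(_ s)/(_ erefl)//].
by apply: thin_op_perm; rewrite perm_sym.
Qed.

(** The relation K D_i = r D_i K: a particle singled out after thinning is a particle singled out
    before, kept with probability [r], while the others are thinned as usual. *)
Lemma thin_op_remove f i s :
  thin_op (fun x => (x i)%:R * f (remove x 1 i)) s =
  r * (count_mem i s)%:R * thin_op f (rem i s).
Proof.
elim: s f => [|k s ih] f /=; first by rewrite /cfg /= mul0r mulr0 mul0r.
rewrite ih; have [->|ki] := eqVneq k i; last first.
  rewrite [X in _ + r * X](@eq_thin_op _ (fun x => (x i)%:R * f (add1 (remove x 1 i) k))).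
    by have /= -> := ih (fun x => f (add1 x k)); rewrite add0n; ring.
  move=> s'; rewrite add1_cfg !remove1_cfg add1_cfg /= (negPf ki).
  by rewrite add0n.
(* The commutation relation T_i D_i = D_i T_i + 1: the added particle may itself be the one that is
   removed. *)
rewrite [X in _ + r * X](@eq_thin_op _ (fun x => (x i)%:R * f (add1 (remove x 1 i) i) + f x)).
  rewrite thin_opD natrD; have /= -> := ih (fun x => f (add1 x i)).
  have [si|/count_memPn->] := boolP (i \in s); last ring.
  by rewrite (thin_op_perm _ (perm_to_rem si)) /=; ring.
move=> s'; rewrite add1_cfg !remove1_cfg add1_cfg /= eqxx add1n.
have [si|/count_memPn si] := boolP (i \in s').
  by rewrite -(cfg_perm (perm_to_rem si)) -natr1; ring.
by rewrite /cfg si mul0r add0r mul1r.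
Qed.

End thinning_operator.

(** * The generator *)
Section generator.
Context {R : realType} {L : countType}.
Implicit Types (s : seq L) (f g : config L -> R) (x : config L) (i j k : L).

Definition bounded_on_fin f := exists M : R, forall s, `|f (cfg s)| <= M.

Definition unit_on_fin f := forall s, 0 <= f (cfg s) <= 1.

Lemma unit_bounded f : unit_on_fin f -> bounded_on_fin f.
Proof. by move=> f01; exists 1 => s; have /andP[f0 f1] := f01 s; rewrite ger0_norm. Qed.

Lemma sum_pred1_count s i : \sum_(k <- s) ((k == i)%:R : R) = (count_mem i s)%:R.
Proof. by elim: s => [|k s ih]; rewrite ?big_nil// big_cons ih /= natrD. Qed.

Lemma abs_summable_count s (h : L -> R) :
  abs_summable [set: L] (fun i => (count_mem i s)%:R * h i).
Proof.
by apply: (@abs_summable_finite _ _ _ _ s) => i _ /count_memPn ->; rewrite mul0r.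
Qed.

Lemma asum_count s (h : L -> R) :
  asum [set: L] (fun i => (count_mem i s)%:R * h i) = \sum_(k <- s) h k.
Proof.
rewrite (eq_asum (g := fun i => \sum_(k <- s) ((i == k)%:R * h k))); last first.
  move=> i _; rewrite -sum_pred1_count mulr_suml; apply: eq_bigr => k _.
  by rewrite (eq_sym k); case: eqVneq => [->//|_]; rewrite !mul0r.
have fin k : abs_summable [set: L] (fun i => (i == k)%:R * h k).
  by apply: (@abs_summable_finite _ _ _ _ [:: k]) => i _; rewrite inE => /negPf->; rewrite mul0r.
rewrite asum_sum//; apply: eq_bigr => k _.
rewrite (@asum_finite _ _ _ _ [:: k])//; first by rewrite big_seq1 eqxx mul1r.
by move=> i _; rewrite inE => /negPf->; rewrite mul0r.
Qed.

Section jumps.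
Variable q : L -> L -> R.
Hypothesis hq : jump_rates q.

Let q0 i j : 0 <= q i j. Proof. by have [] := hq. Qed.

Lemma jump_rate_bound : exists2 M : R, 0 <= M & forall s,
  abs_summable [set: L * L] (fun ij => q ij.1 ij.2 * (count_mem ij.1 s)%:R) /\
  asum [set: L * L] (fun ij => q ij.1 ij.2 * (count_mem ij.1 s)%:R)
    <= M * (size s)%:R.
Proof.
have [_ _ supq _ _] := hq.
set S := ereal_sup _ in supq.
have leS i : (\esum_(j in [set: L]) (q i j)%:E <= S)%E.
  by apply: ereal_sup_ubound; exists i.
(* Over an empty lattice the supremum [S] is -oo; the maximum with 0 keeps the bound finite and
   nonnegative. *)
exists (fine (maxe 0%E S)).
  by apply: fine_ge0; rewrite le_max lexx.
have maxfin : maxe 0%E S \is a fin_num.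
  by rewrite ge0_fin_numE ?le_max ?lexx// gt_max supq ltry.
have esumq k : (\esum_(ij in [set: L * L]) (q ij.1 ij.2 * (k == ij.1)%:R)%:E
    <= maxe 0 S)%E.
  apply: (@le_trans _ _ (\esum_(j in [set: L]) (q k j)%:E)); last first.
    by rewrite le_max leS orbT.
  (* As an iterated sum over [i] then [j], only the row i = k survives, and its total is at most
     [S]. *)
  have -> : [set: L * L] = [set: L] `*`` (fun=> [set: L]).
    by apply/seteqP; split.
  rewrite -(@esum_esum _ _ _ [set: L] (fun=> [set: L])
    (fun i j => (q i j * (k == i)%:R)%:E)); last first.
    by move=> i j _ _; rewrite lee_fin mulr_ge0.
  rewrite (eq_esum (b := fun i => if i \in [set k]
    then \esum_(j in [set: L]) (q k j)%:E else 0%E)); last first.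
    move=> i _; have [<-|ki] := eqVneq k i.
      rewrite (@mem_set _ [set k] k)//; apply: eq_esum => j _.
      by rewrite mulr1.
    rewrite (@memNset _ [set k] i); last by move=> /esym/eqP; rewrite (negPf ki).
    by rewrite esum1// => j _; rewrite mulr0.
  rewrite -esum_mkcond esum_set1//.
  by apply: esum_ge0 => j _; rewrite lee_fin.
have sumq k : abs_summable [set: L * L] (fun ij => q ij.1 ij.2 * (k == ij.1)%:R).
  apply: ge0_abs_summable => [ij _|]; first by rewrite mulr_ge0.
  by apply: le_lt_trans (esumq k) _; rewrite -ge0_fin_numE ?le_max ?lexx.
move=> s.
have -> : (fun ij : L * L => q ij.1 ij.2 * (count_mem ij.1 s)%:R) =
    (fun ij => \sum_(k <- s) q ij.1 ij.2 * (k == ij.1)%:R).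
  by apply/funext => ij; rewrite -sum_pred1_count mulr_sumr.
split; first exact: abs_summable_sum.
rewrite asum_sum// -sum1_size natr_sum mulr_sumr; apply: ler_sum => k _.
have ge0 ij : [set: L * L] ij -> 0 <= q ij.1 ij.2 * (k == ij.1)%:R.
  by move=> _; rewrite mulr_ge0.
by rewrite mulr1 -lee_fin ge0_asumE ?fineK//; exact: abs_summable_ge0.
Qed.

Definition jump_term f x (ij : L * L) : R :=
  q ij.1 ij.2 * (x ij.1)%:R * (f (jump x ij.1 ij.2) - f x).

(** A particle can have infinitely many jump targets, so boundedness of [f] is what makes this sum
    converge: each increment is at most 2M and the total jump rate is finite. *)
Lemma abs_summable_jump f s : bounded_on_fin f ->
  abs_summable [set: L * L] (jump_term f (cfg s)).
Proof.
move=> [M fM]; have [K K0 /(_ s)[sq _]] := jump_rate_bound.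
apply: le_abs_summable (abs_summableZ (2 * M) sq) => -[i j] _.
rewrite /jump_term /= normrM [leRHS]normrM mulrC.
have [si|/count_memPn si] := boolP (i \in s); last first.
  by rewrite /cfg si !mulr0 normr0 !mulr0.
rewrite ler_wpM2r// jump_cfg// (le_trans (ler_normB _ _))//.
by rewrite (le_trans (lerD (fM _) (fM _)))// mulr2n mulrDl mul1r ler_norm.
Qed.

End jumps.

Section local_terms.
Variables a b c d : R.

Definition local_term f x i : R :=
  a * ((x i)%:R * ((x i)%:R - 1) * (f (remove x 2 i) - f x))
  + b * ((x i)%:R * (f (add1 x i) - f x))
  + c * ((x i)%:R * ((x i)%:R - 1) * (f (remove x 1 i) - f x))
  + d * ((x i)%:R * (f (remove x 1 i) - f x)).

Lemma abs_summable_local f s : abs_summable [set: L] (local_term f (cfg s)).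
Proof.
apply: (@abs_summable_finite _ _ _ _ s) => i _ /count_memPn si.
by rewrite /local_term /cfg si !mul0r !mulr0 !addr0.
Qed.

Lemma branco_generatorE q f s :
  branco_generator q a b c d f (cfg s) =
  asum [set: L * L] (jump_term q f (cfg s)) + asum [set: L] (local_term f (cfg s)).
Proof.
have S (h : L -> R) : abs_summable [set: L] (fun i => (cfg s i)%:R * h i).
  exact: abs_summable_count.
have S2 (h : L -> R) : abs_summable [set: L] (fun i => (cfg s i)%:R * ((cfg s i)%:R - 1) * h i).
  have := S (fun i => ((cfg s i)%:R - 1) * h i).
  by under eq_fun do rewrite mulrA.
set x := cfg s in S S2 *.
have sA := S2 (fun i => f (remove x 2 i) - f x).
have sB := S (fun i => f (add1 x i) - f x).
have sC := S2 (fun i => f (remove x 1 i) - f x).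
have sD := S (fun i => f (remove x 1 i) - f x).
have sAB := abs_summableD (abs_summableZ a sA) (abs_summableZ b sB).
have sABC := abs_summableD sAB (abs_summableZ c sC).
have -> : asum [set: L] (local_term f x) =
    a * asum [set: L] (fun i => (x i)%:R * ((x i)%:R - 1) * (f (remove x 2 i) - f x))
  + b * asum [set: L] (fun i => (x i)%:R * (f (add1 x i) - f x))
  + c * asum [set: L] (fun i => (x i)%:R * ((x i)%:R - 1) * (f (remove x 1 i) - f x))
  + d * asum [set: L] (fun i => (x i)%:R * (f (remove x 1 i) - f x)).
  apply: (etrans (asumD sABC (abs_summableZ d sD))).
  congr (_ + _); last exact: asumZ sD.
  apply: (etrans (asumD sAB (abs_summableZ c sC))).
  congr (_ + _); last exact: asumZ sC.
  apply: (etrans (asumD (abs_summableZ a sA) (abs_summableZ b sB))).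
  by congr (_ + _); [exact: asumZ sA|exact: asumZ sB].
by rewrite !addrA.
Qed.

End local_terms.

Lemma branco_generatorD q a b c d f g s : jump_rates q ->
  bounded_on_fin f -> bounded_on_fin g ->
  branco_generator q a b c d (fun x => f x + g x) (cfg s) =
  branco_generator q a b c d f (cfg s) + branco_generator q a b c d g (cfg s).
Proof.
move=> hq bf bg; rewrite !branco_generatorE [RHS]addrACA -!asumD.
- congr (_ + _); apply: eq_asum => e _; rewrite /jump_term /local_term; ring.
- exact: abs_summable_local.
- exact: abs_summable_local.
- exact: abs_summable_jump.
- exact: abs_summable_jump.
Qed.

Lemma branco_generatorZ q a b c d (l : R) f s : jump_rates q -> bounded_on_fin f ->
  branco_generator q a b c d (fun x => l * f x) (cfg s) =
  l * branco_generator q a b c d f (cfg s).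
Proof.
move=> hq bf; rewrite !branco_generatorE mulrDr -!asumZ.
- congr (_ + _); apply: eq_asum => e _; rewrite /jump_term /local_term; ring.
- exact: abs_summable_local.
- exact: abs_summable_jump.
Qed.

(** * The intertwining relation for the generators *)

Section intertwining.
Variables (q : L -> L -> R) (a b c d alpha : R).
Hypotheses (hq : jump_rates q) (alpha0 : 0 <= alpha) (aE : a = alpha * (a + c)).
Let r := 1 / (1 + alpha).

(** The jump term is D_i (T_j - T_i). The factor [r] in K D_i = r D_i K is the one in T_j K - T_i K
    = r K (T_j - T_i), so jump rates are unchanged. *)
Lemma thin_op_jump_term f s ij :
  thin_op r (fun x => jump_term q f x ij) s = jump_term q (thin_fun r f) (cfg s) ij.
Proof.
case: ij => i j; rewrite /jump_term /=.
pose D g x := (x i)%:R * g (remove x 1 i) : R.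
rewrite (@eq_thin_op _ _ _ _ (fun x => q i j *
  (D (fun y => f (add1 y j)) x - D (fun y => f (add1 y i)) x))).
  rewrite thin_opZ thin_opB !thin_op_remove.
  have [si|/count_memPn si] := boolP (i \in s); last first.
    by rewrite /cfg si !mulr0 !mul0r subrr mulr0.
  rewrite jump_cfg// !thin_fun_cfg (thin_op_perm _ f (perm_to_rem si)) /= /cfg.
  ring.
move=> s'; rewrite /D remove1_cfg !add1_cfg.
have [si|/count_memPn si] := boolP (i \in s'); last first.
  by rewrite /cfg si !mulr0 !mul0r subrr mulr0.
by rewrite jump_cfg// (cfg_perm (perm_to_rem si)) -mulrBr mulrA.
Qed.

Lemma thin_op_local_term f s i :
  thin_op r (fun x => local_term a b c d f x i) s =
  local_term 0 ((1 + alpha) * b) (a + c) (alpha * b + d) (thin_fun r f) (cfg s) i.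
Proof.
pose D g x := (x i)%:R * g (remove x 1 i) : R.
pose T g x := g (add1 x i) : R.
(* Every on-site term becomes a word in [D] and [T] with the [D] outermost: x(i) f(x) is D T f,
   x(i)(x(i) - 1) f(x) is D D T T f. Then [thin_op_remove] strips off the [D], each at the price of
   a factor [r]. *)
rewrite (@eq_thin_op _ _ _ _ (fun x =>
    a * (D (D f) x - D (D (T (T f))) x) + b * (D (T (T f)) x - D (T f) x)
  + (c * (D (D (T f)) x - D (D (T (T f))) x) + d * (D f x - D (T f) x)))).
  have thD g s' : thin_op r (D g) s' = r * (count_mem i s')%:R * thin_op r g (rem i s').
    exact: thin_op_remove.
  rewrite !(thin_opB, thin_opD, thin_opZ) !thD /local_term.
  have [si|/count_memPn si] := boolP (i \in s); last first.
    by rewrite /cfg si; ring.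
  rewrite (cfg_perm (perm_to_rem si)).
  have -> : count_mem i s = (count_mem i (rem i s)).+1.
    by have /seq.permP -> := perm_to_rem si; rewrite /= eqxx.
  move: (rem i s) => {si} s1.
  rewrite remove1_head remove2_head add1_cfg cfg_head /cfg !thin_fun_cfg /= -!natr1 addrK.
  have r0 : 1 + alpha != 0 by rewrite gt_eqF// ltr_pwDl.
  (* Substituting a = alpha A and c = A - alpha A builds the relation between the parameters into
     the goal, which becomes a rational identity in free variables. *)
  have [A aA cA] : exists2 A, a = alpha * A & c = A - alpha * A.
    by exists (a + c); rewrite -?aE// addrAC subrr add0r.
  rewrite aA cA.
  (* One particle at [i] has been split off; pair terms are present only if a second one remains. *)
  have [s1i|/count_memPn s1i] := boolP (i \in s1); last first.
    by rewrite s1i /r; field.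
  rewrite !(thin_op_perm _ _ (perm_to_rem s1i)) /=.
  move: (thin_op _ _ _) => k0; move: (thin_op _ _ _) => k1.
  by rewrite /r; field.
move=> s'; have [si|/count_memPn si] := boolP (i \in s'); last first.
  by rewrite /local_term /D /cfg si; ring.
rewrite (cfg_perm (perm_to_rem si)); move: (rem i s') => {si} s1.
rewrite /local_term /D /T remove2_head !remove1_head !add1_cfg cfg_head -natr1 addrK.
have [s1i|/count_memPn s1i] := boolP (i \in s1); last first.
  by have -> : cfg s1 i = 0%N by []; ring.
have E1 : cfg (i :: rem i s1) = cfg s1 by rewrite -(cfg_perm (perm_to_rem s1i)).
rewrite remove1_cfg !add1_cfg E1 -add1_cfg -(add1_cfg (i :: rem i s1)) E1.
by rewrite !add1_cfg; ring.
Qed.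

Lemma thin_op_generator f s : bounded_on_fin f ->
  thin_op r (branco_generator q a b c d f) s =
  branco_generator q 0 ((1 + alpha) * b) (a + c) (alpha * b + d)
    (thin_fun r f) (cfg s).
Proof.
move=> bf; rewrite branco_generatorE.
rewrite (@eq_thin_op _ _ _ _ (fun x => asum [set: L * L] (fun e => jump_term q f x e)
  + asum [set: L] (fun i => local_term a b c d f x i))); last first.
  by move=> s'; rewrite branco_generatorE.
rewrite thin_opD.
have [_ ->] := @thin_op_asum _ _ r _ [set: L * L] (fun e x => jump_term q f x e) s
  (fun s' => abs_summable_jump hq s' bf).
have [_ ->] := @thin_op_asum _ _ r _ [set: L] (fun i x => local_term a b c d f x i) s
  (fun s' => abs_summable_local a b c d f s').
congr (_ + _); apply: eq_asum => e _; first exact: thin_op_jump_term.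
exact: thin_op_local_term.
Qed.

End intertwining.

(* The Lyapunov function [1 + size s] grows at rate at most [b], the only
   transitions increasing it being the branchings. *)
Lemma branco_generator_drift q (a b c d : R) : jump_rates q ->
  0 <= a -> 0 <= b -> 0 <= c -> 0 <= d ->
  exists2 K : R, 0 <= K & forall f (m : R) s, bounded_on_fin f -> 0 <= m ->
    (forall s', f (cfg s') <= m * (1 + (size s')%:R)) ->
    branco_generator q a b c d f (cfg s) <=
      K * (size s)%:R ^+ 2 * (m * (1 + (size s)%:R) - f (cfg s))
      + m * b * (size s)%:R.
Proof.
move=> hq a0 b0 c0 d0; have [M M0 hM] := jump_rate_bound hq.
have q0 i j : 0 <= q i j by case: hq.
(* With n the size of [s], total jump, branching and death rates are bounded by multiples of n <=
   n^2, and pair rates by multiples of n^2. *)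
exists (M + a + b + c + d); first by rewrite !addr_ge0.
move=> f m s bf m0 fm; have [Sq leM] := hM s.
rewrite branco_generatorE; set n : R := (size s)%:R in leM *.
(* The slack of the bound at [cfg s]: a transition that does not enlarge the configuration raises
   [f] by at most [del], a branching by at most [del + m]. *)
set del := m * (1 + n) - f (cfg s).
have del0 : 0 <= del by rewrite subr_ge0 fm.
have fdel s' : (size s' <= size s)%N -> f (cfg s') - f (cfg s) <= del.
  move=> s's; rewrite lerD2r (le_trans (fm _))// ler_wpM2l// lerD2l ler_nat//.
have n0 : 0 <= n by [].
have nn : n <= n ^+ 2.
  rewrite /n; case: (size s) => [|k]; first by rewrite expr0n.
  by rewrite expr2 ler_peMl// ler1n.
have size_rem' i s' : (size (rem i s') <= size s')%N.
  have [is'|is'] := boolP (i \in s'); last by rewrite rem_id.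
  by rewrite size_rem// leq_pred.
have J : asum [set: L * L] (jump_term q f (cfg s)) <= M * n * del.
  apply: (@le_trans _ _ (del * asum [set: L * L]
      (fun ij => q ij.1 ij.2 * (count_mem ij.1 s)%:R))); last first.
    by rewrite mulrC ler_wpM2r.
  rewrite -asumZ//; apply: le_asum; first exact: abs_summable_jump.
    exact: abs_summableZ.
  move=> [i j] _; rewrite /jump_term /=.
  have [si|/count_memPn si] := boolP (i \in s); last first.
    by rewrite /cfg si !mulr0 mul0r lexx.
  rewrite [leRHS]mulrC ler_wpM2l ?mulr_ge0//.
  rewrite jump_cfg// fdel//= size_rem//.
  by case: (s) si.
have Lo : asum [set: L] (local_term a b c d f (cfg s)) <=
    n * ((a + c) * n * del + b * (del + m) + d * del).
  apply: (@le_trans _ _ (asum [set: L] (fun i => (count_mem i s)%:R *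
     ((a + c) * n * del + b * (del + m) + d * del)))); last first.
    by rewrite asum_count big_const_seq count_predT iter_addr addr0 -mulr_natl.
  apply: le_asum; [exact: abs_summable_local|exact: abs_summable_count|].
  move=> i _; rewrite /local_term.
  have [si|/count_memPn si] := boolP (i \in s); last first.
    by rewrite /cfg si; lra.
  have sz := size_rem' i s.
  have f1 : f (remove (cfg s) 1 i) - f (cfg s) <= del by rewrite remove1_cfg fdel.
  have f2 : f (remove (cfg s) 2 i) - f (cfg s) <= del.
    by rewrite remove2_cfg fdel// (leq_trans (size_rem' _ _)).
  have f3 : f (add1 (cfg s) i) - f (cfg s) <= del + m.
    rewrite add1_cfg /del; have := fm (i :: s); rewrite /= -natr1; lra.
  have x1 : 0 <= (cfg s i)%:R - 1 :> R.
    by rewrite subr_ge0 ler1n /cfg -has_count has_pred1.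
  have xn : (cfg s i)%:R - 1 <= n.
    by rewrite lerBlDr (@le_trans _ _ n)// ?lerDl// ler_nat count_size.
  rewrite -/(cfg s i); set x : R := (cfg s i)%:R in x1 xn *.
  have x0 : 0 <= x by [].
  have e1 u : u <= del -> (x - 1) * u <= n * del.
    by move=> ud; rewrite (le_trans (ler_wpM2l x1 ud))// ler_wpM2r.
  rewrite [leRHS](_ : _ = a * (x * (n * del)) + b * (x * (del + m))
    + c * (x * (n * del)) + d * (x * del)); last by ring.
  rewrite !lerD// ler_wpM2l// -?mulrA ler_wpM2l// ?e1//.
apply: (le_trans (lerD J Lo)).
have : (M * n + (a + c) * n * n + b * n + d * n) * del <= (M + a + b + c + d) * n ^+ 2 * del.
  apply: ler_wpM2r => //; rewrite expr2 in nn *.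
  have := ler_wpM2l M0 nn; have := ler_wpM2l b0 nn; have := ler_wpM2l d0 nn; lra.
lra.
Qed.

End generator.

(** * Chains on finite configurations *)
Lemma exchange_esum (R : realType) (T1 T2 : choiceType) (D1 : set T1) (D2 : set T2)
    (h : T1 -> T2 -> \bar R) :
  (forall i j, D1 i -> D2 j -> (0 <= h i j)%E) ->
  \esum_(i in D1) \esum_(j in D2) h i j = \esum_(j in D2) \esum_(i in D1) h i j.
Proof.
move=> h0; rewrite !esum_esum//; last by move=> i j *; exact: h0.
rewrite (reindex_esum (D2 `*`` (fun=> D1)) _ (fun x => (x.2, x.1)))//; split=> //=.
- by move=> [i j] /= [].
- by move=> [i1 j1] [i2 j2] /= _ _ [-> ->].
- by move=> [i j] /= [Di Dj]; exists (j, i).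
Qed.

Lemma near_all_seq (R : realType) (T : eqType) (F : set_system R) (A : seq T) (P : T -> R -> Prop) :
  Filter F -> (forall y, y \in A -> \forall h \near F, P y h) ->
  \forall h \near F, forall y, y \in A -> P y h.
Proof.
move=> FF; elim: A => [|y A ih] AP; first exact: nearW.
have Py := AP y (mem_head _ _).
have PA : \forall h \near F, forall y, y \in A -> P y h.
  by apply: ih => z zA; apply: AP; rewrite inE zA orbT.
apply: filterS2 Py PA => h Ph PAh z; rewrite inE => /orP[/eqP->//|]; exact: PAh.
Qed.

Section chain.
Context {R : realType} {L : countType}.
Implicit Types (s : seq L) (f g : config L -> R) (x y z : config L) (i j k : L).

Definition semigroup (p : R -> config L -> config L -> R) (t : R) f x : R :=
  asum (@fin_config R L) (fun y => p t x y * f y).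

Lemma bounded_on_finD f g : bounded_on_fin f -> bounded_on_fin g ->
  bounded_on_fin (fun x => f x + g x).
Proof.
move=> [M fM] [N gN]; exists (M + N) => s.
by rewrite (le_trans (ler_normD _ _))// lerD.
Qed.

Lemma bounded_on_finZ (l : R) f : bounded_on_fin f -> bounded_on_fin (fun x => l * f x).
Proof. by move=> [M fM]; exists (`|l| * M) => s; rewrite normrM ler_wpM2l. Qed.

Lemma bounded_on_fin_sum (A : seq (config L)) (F : config L -> config L -> R) :
  (forall y, bounded_on_fin (F y)) -> bounded_on_fin (fun x => \sum_(y <- A) F y x).
Proof.
move=> bF; elim: A => [|y A ih]; first by exists 0 => s; rewrite big_nil normr0.
by under eq_fun do rewrite big_cons; exact: bounded_on_finD.
Qed.

Lemma bounded_indic (y : config L) : bounded_on_fin (\1_[set y] : config L -> R).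
Proof.
by apply: unit_bounded => s; rewrite indicE; case: (_ \in _); rewrite ?ler01 ?lexx.
Qed.

Lemma fin_cfg s : @fin_config R L (cfg s).
Proof. by apply/fin_configP; exists s. Qed.

Section one_chain.
Variables (q : L -> L -> R) (a b c d : R) (p : R -> config L -> config L -> R).
Hypotheses (hq : jump_rates q) (hp : branco_chain q a b c d p).
Let G := branco_generator q a b c d.
Let P := semigroup p.

Let p0 (t : R) s y : 0 <= t -> @fin_config R L y -> 0 <= p t (cfg s) y.
Proof. by move=> t0 yf; have [+ _ _ _ _] := hp; apply => //; exact: fin_cfg. Qed.

Lemma abs_summable_chain (t : R) s : 0 <= t ->
  abs_summable (@fin_config R L) (p t (cfg s)).
Proof.
move=> t0; apply: ge0_abs_summable => [y yf|]; first exact: p0.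
have [_ p1 _ _ _] := hp; rewrite p1 ?ltry//. exact: fin_cfg.
Qed.

Lemma asum_chain (t : R) s : 0 <= t -> asum (@fin_config R L) (p t (cfg s)) = 1.
Proof.
move=> t0; apply: EFin_inj; rewrite ge0_asumE.
- have [_ p1 _ _ _] := hp; rewrite p1//; exact: fin_cfg.
- by move=> y; exact: p0.
- have [_ p1 _ _ _] := hp; rewrite p1 ?ltry//; exact: fin_cfg.
Qed.

Lemma abs_summable_chainM (t : R) s f : 0 <= t -> unit_on_fin f ->
  abs_summable (@fin_config R L) (fun y => p t (cfg s) y * f y).
Proof.
move=> t0 f01; apply: le_abs_summable (abs_summable_chain s t0) => y.
move=> /fin_configP[s' ->]; rewrite normrM ler_piMr//.
by have /andP[f0 f1] := f01 s'; rewrite ger0_norm.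
Qed.

Lemma semigroup_unit (t : R) f : 0 <= t -> unit_on_fin f -> unit_on_fin (P t f).
Proof.
move=> t0 f01 s; apply/andP; split.
  apply: asum_ge0 => y yf; apply: mulr_ge0; first exact: p0.
  by move: yf => /fin_configP[s' ->]; have /andP[] := f01 s'.
rewrite -(asum_chain s t0); apply: le_asum; first exact: abs_summable_chainM.
  exact: abs_summable_chain.
move=> y yf; apply: ler_piMr; first exact: p0.
by move: yf => /fin_configP[s' ->]; have /andP[] := f01 s'.
Qed.

Lemma semigroupC (t : R) f s : 0 <= t -> unit_on_fin f ->
  P t (fun x => 1 - f x) (cfg s) = 1 - P t f (cfg s).
Proof.
move=> t0 f01; rewrite -[X in X - _](asum_chain s t0) /P /semigroup -asumB.
- by apply: eq_asum => y _; rewrite mulrBr mulr1.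
- exact: abs_summable_chain.
- exact: abs_summable_chainM.
Qed.

Lemma semigroup0 f s : P 0 f (cfg s) = f (cfg s).
Proof.
have [_ _ p00 _ _] := hp; rewrite /P /semigroup.
rewrite (@asum_finite _ _ _ _ [:: cfg s])//.
- rewrite big_seq1 p00; [|exact: fin_cfg..].
  by rewrite indicE mem_set// mul1r.
- by move=> y; rewrite inE => /eqP ->; exact: fin_cfg.
- move=> y yf; rewrite inE => ys; rewrite p00//; last exact: fin_cfg.
  rewrite indicE memNset ?mul0r// => /= sy.
  by rewrite sy eqxx in ys.
Qed.

(** Chapman-Kolmogorov, with the two sums exchanged by Tonelli since f >= 0. *)
Lemma semigroupD (s t : R) f x : 0 <= s -> 0 <= t -> unit_on_fin f ->
  @fin_config R L x -> P (s + t) f x = P s (P t f) x.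
Proof.
move=> s0 t0 f01 xf; apply: EFin_inj.
have [_ _ _ pD _] := hp.
have st0 : 0 <= s + t by rewrite addr_ge0.
have f0 y : fin_config (R := R) y -> 0 <= f y.
  by move=> /fin_configP[s' ->]; have /andP[] := f01 s'.
have pf0 r s' y : 0 <= r -> fin_config (R := R) y -> 0 <= p r (cfg s') y * f y.
  by move=> r0 yf; rewrite mulr_ge0 ?p0 ?f0.
have PE r s' : 0 <= r -> (P r f (cfg s'))%:E =
    \esum_(y in fin_config (R := R)) (p r (cfg s') y * f y)%:E.
  move=> r0; rewrite /P /semigroup ge0_asumE//; first by move=> y; exact: pf0.
  by apply: abs_summable_ge0; [move=> y; exact: pf0|exact: abs_summable_chainM].
have [s' xs'] := (fin_configP x).1 xf.
rewrite {}xs' in xf *.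
have Pu := semigroup_unit t0 f01.
have PP0 y : fin_config (R := R) y -> 0 <= p s (cfg s') y * P t f y.
  move=> yf; apply: mulr_ge0; first exact: p0.
  by move: yf => /fin_configP[s'' ->]; have /andP[] := Pu s''.
rewrite PE// [RHS]ge0_asumE//; last first.
  by apply: abs_summable_ge0 => //; exact: abs_summable_chainM.
transitivity (\esum_(z in fin_config (R := R)) \esum_(y in fin_config (R := R))
    (f z * (p s (cfg s') y * p t y z))%:E).
  apply: eq_esum => z zf; rewrite mulrC EFinM pD// -esumZ ?f0//.
rewrite exchange_esum; last first.
  move=> z y zf /fin_configP[s'' ->]; rewrite lee_fin.
  by rewrite !mulr_ge0 ?f0 ?p0//; exact: fin_cfg.
apply: eq_esum => y yf; have [s'' ys''] := (fin_configP y).1 yf.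
rewrite EFinM ys'' PE// -esumZ; last by apply: p0 => //; exact: fin_cfg.
by apply: eq_esum => z _; congr EFin; ring.
Qed.

Lemma branco_generator_sum s (A : seq (config L)) (F : config L -> config L -> R) :
  (forall y, bounded_on_fin (F y)) ->
  G (fun x => \sum_(y <- A) F y x) (cfg s) = \sum_(y <- A) G (F y) (cfg s).
Proof.
move=> bF; elim: A => [|y A ih].
  (* The empty sum is the zero function, written as 0 times the constant 1 (the indicator of [x] at
     [x]) so that homogeneity applies. *)
  rewrite big_nil /G (_ : (fun=> _) = (fun x => 0 * \1_[set x] x : R)).
    rewrite (@branco_generatorZ _ _ q a b c d 0 (fun x => \1_[set x] x))// ?mul0r//.
    by exists 1 => s'; rewrite indicE mem_set// normr1.
  by apply/funext => x; rewrite big_nil mul0r.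
rewrite big_cons -ih /G.
under eq_fun do rewrite big_cons.
by rewrite branco_generatorD//; exact: bounded_on_fin_sum.
Qed.

(* All but a small fraction of the rate out of [cfg s] leads to finitely many
   configurations, uniformly in the test function. *)
Lemma branco_generator_tight s (e : R) : 0 < e -> exists A : seq (config L),
  [/\ uniq A, cfg s \in A, forall y, y \in A -> @fin_config R L y &
    forall f, unit_on_fin f ->
      G f (cfg s) <= \sum_(y <- A) f y * G \1_[set y] (cfg s) + e].
Proof.
move=> e0; have q0 i j : 0 <= q i j by case: hq.
have [M M0 /(_ s)[Sq _]] := jump_rate_bound hq.
have [E leE] := abs_summable_tail (fun ij _ => mulr_ge0 (q0 ij.1 ij.2) (ler0n _ _)) Sq e0.
(* Listed are [s] itself, where the mass sits at time 0, the jumps in [E], outside of which the jump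
   rate is below [e], and all on-site outcomes: a branching, the loss of one particle, the loss of
   two. *)
pose targets : seq (seq L) := s :: [seq ij.2 :: rem ij.1 s | ij <- E] ++
  [seq i :: s | i <- s] ++ [seq rem i s | i <- s] ++
  [seq rem i (rem i s) | i <- s].
pose A : seq (config L) := undup [seq cfg s' | s' <- targets].
have targetA s' : s' \in targets -> cfg s' \in A.
  by move=> s't; rewrite mem_undup; apply: map_f.
exists A; split.
- exact: undup_uniq.
- by apply: targetA; exact: mem_head.
- by move=> y; rewrite mem_undup => /mapP[s' _ ->]; exact: fin_cfg.
move=> f f01; pose f' y : R := f y * (y \notin A)%:R.
have f'01 : unit_on_fin f'.
  move=> s'; have /andP[f0 f1] := f01 s'; rewrite /f'.
  by case: (_ \notin _); rewrite ?mulr1 ?f0// mulr0 lexx ler01.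
have fE : f = (fun x => f' x + \sum_(y <- A) f y * \1_[set y] x).
  apply/funext => x; rewrite /f'; have [xA|xA] := boolP (x \in A).
    rewrite mulr0 add0r (bigD1_seq x)//= ?undup_uniq// indicE mem_set// mulr1.
    rewrite big1 ?addr0// => y yx.
    rewrite indicE memNset ?mulr0//= => xy.
    by rewrite xy eqxx in yx.
  rewrite mulr1 big_seq big1 ?addr0// => y yA.
  rewrite indicE memNset ?mulr0//= => xy.
  by rewrite xy yA in xA.
have bA y : bounded_on_fin (fun x => f y * \1_[set y] x).
  by apply: bounded_on_finZ; exact: bounded_indic.
have -> : G f (cfg s) = G f' (cfg s) + \sum_(y <- A) f y * G \1_[set y] (cfg s).
  rewrite {1}fE /G branco_generatorD//; last 2 first.
  - exact: unit_bounded.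
  - exact: bounded_on_fin_sum.
  congr (_ + _); rewrite [LHS](branco_generator_sum s A bA).
  apply: eq_bigr => y _.
  by rewrite /G branco_generatorZ//; exact: bounded_indic.
rewrite addrC lerD2l /G branco_generatorE.
have f'A s' : cfg s' \in A -> f' (cfg s') = 0.
  by move=> s'A; rewrite /f' s'A mulr0.
have sA : f' (cfg s) = 0 by apply/f'A/targetA; exact: mem_head.
rewrite [X in _ + X]asum0 ?addr0; last first.
  move=> i _; rewrite /local_term.
  have [si|/count_memPn si] := boolP (i \in s); last by rewrite /cfg si; ring.
  rewrite add1_cfg remove1_cfg remove2_cfg sA !f'A ?subrr ?mulr0 ?addr0//.
  1-3: by apply: targetA; rewrite inE !mem_cat ?(map_f _ si) ?orbT.
apply: le_trans (ltW leE); apply: le_asum.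
- by apply: abs_summable_jump => //; exact: unit_bounded.
- apply: le_abs_summable Sq => ij _; rewrite normrM ler_piMr//.
  by case: (_ \notin _); rewrite ?normr0 ?normr1.
move=> [i j] _; rewrite /jump_term /= sA subr0.
have [si|/count_memPn si] := boolP (i \in s); last first.
  by rewrite /cfg si !mulr0 !mul0r.
apply: ler_wpM2l; first by rewrite mulr_ge0.
rewrite jump_cfg//; have [ijE|_] := boolP ((i, j) \in E); last first.
  by have /andP[] := f'01 (j :: rem i s).
rewrite f'A//; apply: targetA; rewrite inE !mem_cat.
by rewrite (map_f (fun ij => ij.2 :: rem ij.1 s) ijE) ?orbT.
Qed.

(** A lower bound is accessible from entrywise derivatives: since f >= 0, the targets outside the
    finite set [A] may be dropped, and finitely many difference quotients converge together. As [A]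
    does not depend on [f], neither does the threshold for [h]. *)
Lemma semigroup_lower s (e : R) : 0 < e ->
  \forall h \near 0^'+, forall f, unit_on_fin f ->
    h * (G f (cfg s) - e) <= P h f (cfg s) - f (cfg s).
Proof.
move=> e0; have e20 : 0 < e / 2 by rewrite divr_gt0.
have [A [uA sA Afin Ale]] := branco_generator_tight s e20.
have sizeA : 0 < (size A)%:R :> R by rewrite ltr0n; case: (A) sA.
(* Half of [e] pays for the targets outside [A]; the other half is shared equally among the entries
   of [A]. *)
pose eta := e / 2 / (size A)%:R.
have eta0 : 0 < eta by rewrite divr_gt0.
have nearA : \forall h \near 0^'+, forall y, y \in A ->
    `|G \1_[set y] (cfg s) - (p h (cfg s) y - p 0 (cfg s) y) / h| < eta.
  apply: near_all_seq => y yA; have [_ _ _ _ der] := hp.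
  have /cvgrPdist_lt/(_ eta eta0) := der _ _ (fin_cfg s) (Afin _ yA).
  exact.
near=> h => f f01.
have h0 : 0 < h by near: h; exact: nbhs_right_gt.
have : forall y, y \in A ->
    `|G \1_[set y] (cfg s) - (p h (cfg s) y - p 0 (cfg s) y) / h| < eta.
  by near: h.
move=> distA.
have lower : \sum_(y <- A) p h (cfg s) y * f y <= P h f (cfg s).
  apply: ge0_asum_ge_finite => //.
    move=> y yf; apply: mulr_ge0; first by apply: p0 => //; exact: ltW.
    by move: yf => /fin_configP[s' ->]; have /andP[] := f01 s'.
  by apply: abs_summable_chainM => //; exact: ltW.
have f0E : f (cfg s) = \sum_(y <- A) p 0 (cfg s) y * f y.
  rewrite -[LHS](semigroup0 f s) /P /semigroup (@asum_finite _ _ _ _ A)//.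
  move=> y yf yA; have [_ _ p00 _ _] := hp; rewrite p00//; last exact: fin_cfg.
  rewrite indicE memNset ?mul0r// => /= sy.
  by rewrite -sy sA in yA.
have step y : y \in A -> h * (f y * G \1_[set y] (cfg s)) - h * eta <=
    p h (cfg s) y * f y - p 0 (cfg s) y * f y.
  move=> yA; have [s' ys'] := (fin_configP y).1 (Afin _ yA).
  have /andP[fy0 fy1] : 0 <= f y <= 1 by rewrite ys'.
  have := distA y yA; set g := G _ _; set dp := p h _ _ - _.
  move=> /ltr_distlBl gdp.
  have lt : (g - eta) * h <= dp by rewrite -ler_pdivlMr//; lra.
  have := ler_wpM2r fy0 lt; rewrite /dp.
  have : eta * h * f y <= eta * h * 1 by rewrite ler_wpM2l// mulr_ge0 ?(ltW eta0) ?(ltW h0)//.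
  lra.
apply: (@le_trans _ _ (\sum_(y <- A) (h * (f y * G \1_[set y] (cfg s)) - h * eta))).
  rewrite sumrB -mulr_sumr big_const_seq count_predT iter_addr addr0.
  rewrite -mulr_natr -mulrA /eta divfK ?gt_eqF//.
  rewrite -mulrBr ler_wpM2l ?(ltW h0)//; have := Ale f f01; lra.
apply: (@le_trans _ _ (\sum_(y <- A) (p h (cfg s) y * f y - p 0 (cfg s) y * f y))).
  by rewrite big_seq [leRHS]big_seq; apply: ler_sum.
by rewrite sumrB -f0E lerD2r.
Unshelve. all: by end_near. Qed.

(** The upper bound is the lower bound for 1 - f: total mass 1 gives P_h (1 - f) = 1 - P_h f, and G
    (1 - f) = - G f. Nonexplosion enters here. *)
Lemma semigroup_approx s (e : R) : 0 < e ->
  \forall h \near 0^'+, forall f, unit_on_fin f ->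
    `|P h f (cfg s) - f (cfg s) - h * G f (cfg s)| <= e * h.
Proof.
move=> e0; near=> h => f f01.
have h0 : 0 < h by near: h; exact: nbhs_right_gt.
have lower g : unit_on_fin g -> h * (G g (cfg s) - e) <= P h g (cfg s) - g (cfg s).
  by move: g; near: h; exact: semigroup_lower.
have g01 : unit_on_fin (fun x => 1 - f x).
  by move=> s'; have /andP[f0 f1] := f01 s'; apply/andP; split; lra.
have := lower _ f01; have := lower _ g01.
rewrite semigroupC ?(ltW h0)//.
have -> : G (fun x => 1 - f x) (cfg s) = - G f (cfg s).
  have bf := unit_bounded f01.
  have -> : (fun x => 1 - f x) = (fun x => (fun=> 1) x + (fun x => -1 * f x) x).
    by apply/funext => x; rewrite mulN1r.
  rewrite /G branco_generatorD//; last 2 first.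
  - by exists 1 => s'; rewrite normr1.
  - exact: bounded_on_finZ.
  rewrite branco_generatorZ// mulN1r branco_generatorE.
  rewrite asum0 => [|ij _]; last by rewrite /jump_term subrr mulr0.
  rewrite asum0 => [|i _]; last by rewrite /local_term !subrr; ring.
  by rewrite !add0r.
by move=> ? ?; rewrite ler_distl; apply/andP; split; lra.
Unshelve. all: by end_near. Qed.

End one_chain.
End chain.

(** * Uniqueness of bounded solutions of the backward equation *)
Section bounded_solutions.
Context {R : realType} {L : countType}.
Variables (q : L -> L -> R) (a b c d : R).
Hypotheses (hq : jump_rates q) (a0 : 0 <= a) (b0 : 0 <= b) (c0 : 0 <= c) (d0 : 0 <= d).
Let G := branco_generator q a b c d.

Variable w : R -> config L -> R.
Hypothesis w0 : forall s, w 0 (cfg s) = 0.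
Hypothesis w1 : forall (t : R) s, 0 <= t -> `|w t (cfg s)| <= 1.
(** The threshold for [h] may depend on the configuration but not on [t]; hence one step length
    serves a whole Euler scheme at a fixed configuration. *)
Hypothesis w_step : forall s (e : R), 0 < e -> \forall h \near 0^'+,
  forall t, 0 <= t -> w (t + h) (cfg s) <= w t (cfg s) + h * G (w t) (cfg s) + e * h.

Let V (s : seq L) : R := 1 + (size s)%:R.

Let V0 s : 0 < V s. Proof. by rewrite /V ltr_pwDl. Qed.

(* Euler's scheme for the gap [S e^{bt} V - w]: by the drift inequality a step
   of length [h] multiplies the gap by at least [1 - h * rate]. *)
Lemma euler_gap (K S T : R) :
  (forall f (m : R) s, bounded_on_fin f -> 0 <= m ->
    (forall s', f (cfg s') <= m * (1 + (size s')%:R)) ->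
    G f (cfg s) <= K * (size s)%:R ^+ 2 * (m * (1 + (size s)%:R) - f (cfg s))
      + m * b * (size s)%:R) ->
  0 <= K -> 0 <= S ->
  (forall t s, 0 <= t <= T -> w t (cfg s) <= S * expR (b * t) * V s) ->
  forall t s, 0 <= t <= T -> w t (cfg s) <=
    S * V s * (expR (b * t) - expR (- (2 * (K * (size s)%:R ^+ 2) * t))).
Proof.
move=> drift K0 S0 wS t s /andP[t0 tT].
set Lam := K * (size s)%:R ^+ 2.
have Lam0 : 0 <= Lam by rewrite mulr_ge0.
have [->|tn0] := eqVneq t 0.
  by rewrite w0 !mulr0 oppr0 subrr mulr0.
have {t0 tn0} t0 : 0 < t by rewrite lt_neqAle eq_sym tn0.
apply/ler_addgt0Pr => e e0.
have et0 : 0 < e / t by rewrite divr_gt0.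
have [h0 /= h00 hstep] := w_step s et0.
(* The number of steps makes h = t/n smaller than [h0] and h Lam at most 1/2. *)
pose n := (Num.trunc (t / h0 + 2 * Lam * t)).+1.
have nlt : t / h0 + 2 * Lam * t < n%:R by rewrite truncnS_gt.
have n0 : 0 < n%:R :> R by rewrite ltr0n.
pose h := t / n%:R.
have hgt0 : 0 < h by rewrite divr_gt0.
have hlt : h < h0.
  rewrite /h ltr_pdivrMr// mulrC -ltr_pdivrMr//; apply: le_lt_trans nlt.
  by rewrite lerDl !mulr_ge0// ltW.
have hLam : h * Lam <= 1 / 2.
  rewrite /h mulrAC ler_pdivrMr//.
  have : 0 <= t / h0 by rewrite divr_ge0 ?ltW.
  by move: nlt; lra.
have {}hstep u : 0 <= u -> w (u + h) (cfg s) <= w u (cfg s) + h * G (w u) (cfg s) + e / t * h.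
  by apply: hstep => //=; rewrite sub0r normrN gtr0_norm.
have nh : n%:R * h = t by rewrite /h mulrC divfK ?gt_eqF.
have gap k : (k <= n)%N ->
    (1 - h * Lam) ^+ k * (S * V s) - (e / t) * (k%:R * h) <=
    S * expR (b * (k%:R * h)) * V s - w (k%:R * h) (cfg s).
  elim: k => [|k ih] kn.
    by rewrite !mul0r !mulr0 expR0 w0 !subr0 expr0 mul1r mulr1.
  have {}ih := ih (ltnW kn).
  set u := k%:R * h in ih *.
  have u0 : 0 <= u by rewrite mulr_ge0// ltW.
  have uT : u <= T.
    by apply: le_trans tT; rewrite -nh ler_wpM2r ?(ltW hgt0)// ler_nat ltnW.
  have uh : k.+1%:R * h = u + h by rewrite -natr1 mulrDl mul1r.
  rewrite uh exprSr.
  set m := S * expR (b * u) in ih *.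
  have m0 : 0 <= m by rewrite mulr_ge0// expR_ge0.
  (* The growth term m b n of the drift inequality is absorbed by 1 + b h <= e^{bh}. *)
  have mu : m * (1 + b * h) <= S * expR (b * (u + h)).
    rewrite (mulrDr b) expRD mulrA ler_wpM2l//.
    exact: expR_ge1Dx.
  have := hstep u u0.
  have bw : bounded_on_fin (w u) by exists 1 => s'; exact: w1.
  have /(ler_wpM2l (ltW hgt0)) := drift _ _ s bw m0 (fun s' => wS u s' (introT andP (conj u0 uT))).
  have /(ler_wpM2r (ltW (V0 s))) := mu.
  have hL1 : 0 <= 1 - h * Lam by lra.
  have := ler_wpM2r hL1 ih.
  have et := mulr_ge0 (mulr_ge0 (ltW et0) u0) (mulr_ge0 (ltW hgt0) Lam0).
  have mbh := mulr_ge0 (mulr_ge0 m0 b0) (ltW hgt0).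
  rewrite -/Lam; move: et mbh; rewrite /V.
  set X := (1 - h * Lam) ^+ k; set E := S * expR (b * (u + h)).
  set wu := w u _; set wuh := w (u + h) _; set g := G _ _.
  move: (e / t) => et'.
  lra.
have := gap n (leqnn n); rewrite nh -mulrA (mulrC (_^-1)) divff ?gt_eqF// mulr1.
(* For 0 <= y <= 1/2 one has e^{-2y} <= 1/(1 + 2y) <= 1 - y, here with y = h Lam. *)
have low : expR (- (2 * Lam * t)) <= (1 - h * Lam) ^+ n.
  have -> : - (2 * Lam * t) = n%:R * (- (2 * (h * Lam))) by rewrite -nh; ring.
  rewrite expRM_natl; apply: lerXn2r; rewrite ?nnegrE ?expR_ge0//; first lra.
  have y0 : 0 <= h * Lam by rewrite mulr_ge0// ltW.
  rewrite expRN -[leRHS]invrK lef_pV2 ?posrE ?expR_gt0 ?invr_gt0//; last lra.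
  apply: le_trans (expR_ge1Dx _).
  rewrite -[leLHS]mul1r ler_pdivrMr; last lra.
  nra.
have SV0 : 0 <= S * V s by rewrite mulr_ge0// ltW.
have := ler_wpM2r SV0 low.
nra.
Qed.

(** Suppose the supremum S of w e^{-bt} / V over [0, T] and all finite configurations is positive.
    On large configurations the quotient is at most 1/V <= S/2 because |w| <= 1; on those of size at
    most N, [euler_gap] improves the bound S by a factor 1 - kap with a uniform kap > 0. So S would
    be strictly smaller than itself. *)
Lemma bounded_subsolution_le0 (t : R) s : 0 <= t -> w t (cfg s) <= 0.
Proof.
have [K K0 drift] := branco_generator_drift hq a0 b0 c0 d0.
move=> T0; rewrite leNgt; apply/negP => wpos; move: t T0 s wpos => T T0 s0 wpos.
pose z t s := w t (cfg s) * expR (- (b * t)) / V s.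
pose E := [set x | exists t s, 0 <= t <= T /\ x = z t s].
have zV t s : 0 <= t -> z t s <= 1 / V s.
  move=> t0; rewrite ler_wpM2r ?invr_ge0 ?(ltW (V0 s))//.
  have e1 : expR (- (b * t)) <= 1.
    by rewrite -expR0 ler_expR oppr_le0 mulr_ge0.
  have wle : w t (cfg s) <= 1 by rewrite (le_trans (ler_norm _))// w1.
  rewrite (le_trans (ler_wpM2r (expR_ge0 _) wle))// mul1r//.
have V1 s : 1 <= V s by rewrite /V lerDl.
have supE : has_sup E.
  split; first by exists (z T s0), T, s0; rewrite T0 lexx.
  exists 1 => _ [t [s [/andP[t0 _] ->]]]; rewrite (le_trans (zV _ _ t0))//.
  by rewrite div1r invf_le1.
set S := sup E.
have zS t s : 0 <= t <= T -> z t s <= S.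
  by move=> tT; apply: ub_le_sup; [case: supE|exists t, s].
have Spos : 0 < S.
  apply: lt_le_trans (zS T s0 _); last by rewrite T0 lexx.
  by rewrite /z divr_gt0// mulr_gt0// expR_gt0.
have wS t s : 0 <= t <= T -> w t (cfg s) <= S * expR (b * t) * V s.
  move=> /(zS t s); rewrite /z expRN => zle.
  have := zle; rewrite ler_pdivrMr// ler_pdivrMr ?expR_gt0//.
  by rewrite mulrAC.
have gap := euler_gap drift K0 (ltW Spos) wS.
(* Size above N > 2/S makes 1/V less than S/2. *)
pose N : R := (Num.trunc (2 / S)).+1%:R.
have NS : 2 / S < N by rewrite truncnS_gt.
have N0 : 0 < N by rewrite ltr0n.
(* The smallest gap factor, attained at size [N] and time [T]; the extra [b] comes from the
   normalisation e^{-bt}. *)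
pose kap := expR (- ((2 * (K * N ^+ 2) + b) * T)).
have kap0 : 0 < kap by exact: expR_gt0.
have : S <= S * Num.max (1 / 2) (1 - kap).
  apply: ge_sup; first by case: supE.
  move=> _ [t [s [/andP[t0 tT] ->]]].
  have [sN|Ns] := leP ((size s)%:R : R) N; last first.
    apply: (@le_trans _ _ (S * (1 / 2))); last by rewrite ler_pM2l// le_max lexx.
    apply: (le_trans (zV _ _ t0)); rewrite ler_pdivrMr ?V0//.
    rewrite /V; move: NS; rewrite ltr_pdivrMr//; nra.
  apply: (@le_trans _ _ (S * (1 - kap))); last by rewrite ler_pM2l// le_max lexx orbT.
  have t0T : 0 <= t <= T by rewrite t0.
  rewrite /z ler_pdivrMr//.
  have := ler_wpM2r (expR_ge0 (- (b * t))) (gap t s t0T).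
  move=> /le_trans; apply.
  have expK : expR (b * t) * expR (- (b * t)) = 1 by rewrite -expRD subrr expR0.
  rewrite [leLHS](_ : _ = S * (1 - expR (- (2 * (K * (size s)%:R ^+ 2) * t)) *
    expR (- (b * t))) * V s); last by rewrite -expK; ring.
  rewrite ler_pM2r// ler_pM2l// lerD2l lerN2 -expRD /kap ler_expR.
  have : (size s)%:R ^+ 2 <= N ^+ 2 by rewrite lerXn2r ?nnegrE// ltW.
  move=> /(ler_wpM2l K0) sN2.
  have KN : 0 <= K * N ^+ 2 by rewrite mulr_ge0// exprn_ge0// ltW.
  have Ks : 0 <= K * (size s)%:R ^+ 2 by rewrite mulr_ge0.
  have := ler_wpM2r t0 sN2; have := ler_wpM2l KN tT; have := ler_wpM2l b0 tT.
  nra.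
rewrite -[leLHS]mulr1 ler_pM2l//; rewrite le_max => /orP[]; lra.
Qed.

End bounded_solutions.

(** The backward equation in the sense of right-hand increments: at each configuration the error is
    o(h) uniformly in [t]. *)
Definition unit_solution {R : realType} {L : countType} (q : L -> L -> R)
    (a b c d : R) (u : R -> config L -> R) : Prop :=
  (forall t : R, 0 <= t -> unit_on_fin (u t)) /\
  (forall s (e : R), 0 < e -> \forall h \near 0^'+, forall t : R, 0 <= t ->
    `|u (t + h) (cfg s) - u t (cfg s)
      - h * branco_generator q a b c d (u t) (cfg s)| <= e * h).

Lemma bounded_solution_le {R : realType} {L : countType} (q : L -> L -> R)
    (a b c d : R) (u v : R -> config L -> R) (t : R) s :
  jump_rates q -> 0 <= a -> 0 <= b -> 0 <= c -> 0 <= d ->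
  unit_solution q a b c d u -> unit_solution q a b c d v ->
  (forall s, u 0 (cfg s) = v 0 (cfg s)) -> 0 <= t ->
  u t (cfg s) <= v t (cfg s).
Proof.
move=> hq a0 b0 c0 d0 [u01 u_near] [v01 v_near] uv0 t0; rewrite -subr_le0.
apply: (@bounded_subsolution_le0 _ _ q a b c d hq a0 b0 c0 d0
    (fun t x => u t x - v t x)) => //.
- by move=> s'; rewrite uv0 subrr.
- move=> t' s' t'0; have /andP[? ?] := u01 t' t'0 s'.
  by have /andP[? ?] := v01 t' t'0 s'; rewrite ler_distl; apply/andP; split; lra.
move=> s' e e0; have e20 : 0 < e / 2 by rewrite divr_gt0.
have := u_near s' _ e20; have := v_near s' _ e20; apply: filterS2 => h H1 H2 t' t'0.
have bu := unit_bounded (u01 _ t'0); have bv := unit_bounded (v01 _ t'0).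
have -> : branco_generator q a b c d (fun x => u t' x - v t' x) (cfg s') =
    branco_generator q a b c d (u t') (cfg s')
    - branco_generator q a b c d (v t') (cfg s').
  rewrite (_ : (fun x => _) = (fun x => u t' x + (fun x => -1 * v t' x) x)); last first.
    by apply/funext => x; rewrite mulN1r.
  rewrite branco_generatorD//; last exact: bounded_on_finZ.
  by rewrite branco_generatorZ// mulN1r.
move: (H1 t' t'0) (H2 t' t'0); rewrite !ler_distl => /andP[? ?] /andP[? ?].
lra.
Qed.

(** * The intertwining relation for the semigroups *)

Section semigroup_intertwining.
Context {R : realType} {L : countType}.
Variables (q : L -> L -> R) (a b c d alpha : R).
Variables (p pbar : R -> config L -> config L -> R).
Hypotheses (hq : jump_rates q) (a0 : 0 <= a) (b0 : 0 <= b) (c0 : 0 <= c) (d0 : 0 <= d).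
Hypotheses (alpha0 : 0 <= alpha) (aE : a = alpha * (a + c)).
Hypothesis hp : branco_chain q a b c d p.
Hypothesis hpbar : branco_chain q 0 ((1 + alpha) * b) (a + c) (alpha * b + d) pbar.
Let r := 1 / (1 + alpha).
Let G := branco_generator q a b c d.
Let Gbar := branco_generator q 0 ((1 + alpha) * b) (a + c) (alpha * b + d).

Lemma thin_rate01 : 0 <= r <= 1.
Proof.
have h : 0 < 1 + alpha by rewrite ltr_pwDl.
by rewrite /r divr_ge0 ?(ltW h)//= ler_pdivrMr// mul1r lerDl.
Qed.

Let r01 := thin_rate01.

Lemma unit_thin_op (f : config L -> R) s : unit_on_fin f -> 0 <= thin_op r f s <= 1.
Proof.
move=> f01; apply/andP; split.
  rewrite -(@thin_op_cst _ _ r 0 s); apply: le_thin_op => // s'.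
  by have /andP[] := f01 s'.
rewrite -[leRHS](@thin_op_cst _ _ r 1 s); apply: le_thin_op => // s'.
by have /andP[] := f01 s'.
Qed.

Lemma unit_thin_fun (f : config L -> R) : unit_on_fin f -> unit_on_fin (thin_fun r f).
Proof. by move=> f01 s; rewrite thin_fun_cfg; exact: unit_thin_op. Qed.

(** Thinning averages over finitely many subconfigurations, so the thresholds for [h] at each of
    them can be intersected. *)
Lemma near_thin_op (F : R -> (config L -> R) -> config L -> R) s (e : R) :
  (forall s', \forall h \near 0^'+, forall f, unit_on_fin f -> `|F h f (cfg s')| <= e * h) ->
  \forall h \near 0^'+, forall f, unit_on_fin f -> `|thin_op r (F h f) s| <= e * h.
Proof.
elim: s F => [|i s ih] F near_F /=; first exact: near_F.
have near_F1 : forall s', \forall h \near 0^'+, forall f, unit_on_fin f ->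
    `|F h f (add1 (cfg s') i)| <= e * h by move=> s'; rewrite add1_cfg.
have := ih (fun h f x => F h f (add1 x i)) near_F1.
have := ih F near_F; apply: filterS2 => h H1 H2 f f01.
have /andP[r0 r1] := r01.
rewrite (le_trans (ler_normD _ _))// (normrM (1 - r)) (normrM r) (ger0_norm r0) ger0_norm ?subr_ge0//.
have r1' : 0 <= 1 - r by rewrite subr_ge0.
have := ler_wpM2l r1' (H1 f f01); have := ler_wpM2l r0 (H2 f f01); lra.
Qed.

Theorem semigroup_thin (f : config L -> R) (t : R) s : unit_on_fin f -> 0 <= t ->
  semigroup pbar t (thin_fun r f) (cfg s) = thin_op r (semigroup p t f) s.
Proof.
move=> f01 t0.
have bbar0 : 0 <= (1 + alpha) * b by rewrite mulr_ge0// addr_ge0.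
have cbar0 : 0 <= a + c by rewrite addr_ge0.
have dbar0 : 0 <= alpha * b + d by rewrite addr_ge0// mulr_ge0.
have fb01 := unit_thin_fun f01.
pose u t := semigroup pbar t (thin_fun r f).
pose v t := thin_fun r (semigroup p t f).
have u01 (t' : R) : 0 <= t' -> unit_on_fin (u t') by move=> t'0; exact: semigroup_unit hpbar _ _ t'0 fb01.
have pf01 (t' : R) : 0 <= t' -> unit_on_fin (semigroup p t' f).
  by move=> t'0; exact: semigroup_unit hp _ _ t'0 f01.
have v01 (t' : R) : 0 <= t' -> unit_on_fin (v t') by move=> t'0; exact: unit_thin_fun (pf01 _ t'0).
have uv0 s' : u 0 (cfg s') = v 0 (cfg s').
  rewrite /u /v (semigroup0 hpbar) !thin_fun_cfg; apply: eq_thin_op => s''.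
  by rewrite (semigroup0 hp).
have u_near s' (e : R) : 0 < e -> \forall h \near 0^'+, forall t' : R, 0 <= t' ->
    `|u (t' + h) (cfg s') - u t' (cfg s') - h * Gbar (u t') (cfg s')| <= e * h.
  move=> e0; near=> h => t' t'0.
  have h0 : 0 <= h by near: h; exact: nbhs_right_ge.
  (* Written as a step of length [h] applied to [u t'], the increment depends on [t'] only through
     the test function, over which the approximation is uniform. *)
  rewrite /u (addrC t' h) (semigroupD hpbar)//; last exact: fin_cfg.
  suff H : forall g, unit_on_fin g ->
      `|semigroup pbar h g (cfg s') - g (cfg s') - h * Gbar g (cfg s')| <= e * h.
    exact: H (u01 t' t'0).
  by near: h; exact: (semigroup_approx hq hpbar).
have v_near s' (e : R) : 0 < e -> \forall h \near 0^'+, forall t' : R, 0 <= t' ->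
    `|v (t' + h) (cfg s') - v t' (cfg s') - h * Gbar (v t') (cfg s')| <= e * h.
  move=> e0; near=> h => t' t'0.
  have h0 : 0 <= h by near: h; exact: nbhs_right_ge.
  (* Gbar K = K G applied to P_t' f turns the error for [v] into the thinned error of the original
     chain. *)
  rewrite /v !thin_fun_cfg /Gbar -(@thin_op_generator _ _ q a b c d alpha hq alpha0 aE); last first.
    exact: unit_bounded (pf01 _ t'0).
  rewrite -/r (@eq_thin_op _ _ r _ (semigroup p h (semigroup p t' f))); last first.
    by move=> s''; rewrite (addrC t' h) (semigroupD hp)//; exact: fin_cfg.
  rewrite -thin_opB -thin_opZ -thin_opB.
  suff H : forall g, unit_on_fin g ->
      `|thin_op r (fun x => semigroup p h g x - g x - h * G g x) s'| <= e * h.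
    exact: H (pf01 t' t'0).
  near: h; apply: (@near_thin_op (fun h f x => semigroup p h f x - f x - h * G f x)) => s''.
  exact: (semigroup_approx hq hp).
rewrite -thin_fun_cfg -/(v t) -/(u t).
by apply/eqP; rewrite eq_le !(@bounded_solution_le _ _ q 0 ((1 + alpha) * b) (a + c)
  (alpha * b + d)).
Unshelve. all: by end_near. Qed.

End semigroup_intertwining.

(** * Laws of thinned configurations *)
Section countable_fibers.
Context {d : measure_display} {T : measurableType d} {R : realType} {V : countType}.
Variable X : T -> V.
Hypothesis mX : forall v, measurable (X @^-1` [set v]).

Lemma measurable_fun_fibers d' (U : measurableType d') (h : V -> U) :
  measurable_fun [set: T] (h \o X).
Proof.
move=> _ B mB; rewrite setTI.
have -> : (h \o X) @^-1` B = \bigcup_v (X @^-1` [set v] `&` [set _ | B (h v)]).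
  by apply/seteqP; split=> [w Bw|w [v _ [/= ->]]//]; exists (X w).
apply: countable_bigcupT_measurable => [|v]; first exact: countableP.
apply: measurableI => //; have [Bv|nBv] := pselect (B (h v)).
  by rewrite (_ : [set _ | _] = setT)//; apply/seteqP; split.
by rewrite (_ : [set _ | _] = set0)//; apply/seteqP; split.
Qed.

(** The values of [X] are replaced by their codes, so that splitting an integral along them gives a
    series over nat. *)
Definition fiber (k : nat) : set T := [set w | pickle (X w) = k].

Lemma measurable_fiber k : measurable (fiber k).
Proof.
have -> : fiber k = (pickle \o X) @^-1` [set k] by [].
by rewrite -[X in measurable X]setTI; exact: measurable_fun_fibers.
Qed.

Lemma fiber_cover : \bigcup_k fiber k = [set: T].
Proof. by apply/seteqP; split=> // w _; exists (pickle (X w)). Qed.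

Lemma trivIset_fiber : trivIset [set: nat] fiber.
Proof.
by apply/trivIsetP => i j _ _ ij; apply/seteqP; split=> // w [/= wi wj];
  rewrite -wi -wj eqxx in ij.
Qed.

Lemma integral_fibers (mu : {measure set T -> \bar R}) (h : T -> \bar R) :
  (forall w, 0 <= h w)%E -> measurable_fun [set: T] h ->
  (\int[mu]_w h w = \sum_(k <oo) \int[mu]_(w in fiber k) h w)%E.
Proof.
move=> h0 mh; rewrite -fiber_cover ge0_integral_bigcup//.
- exact: measurable_fiber.
- by rewrite fiber_cover.
- exact: trivIset_fiber.
Qed.

Lemma integral_fibers_comp (mu : {measure set T -> \bar R}) (h : V -> R) :
  (forall v, 0 <= h v) ->
  (\int[mu]_w (h (X w))%:E =
   \sum_(k <oo) (oapp h 0 (unpickle k))%:E * mu (fiber k))%E.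
Proof.
move=> h0; rewrite integral_fibers//; last 2 first.
- by move=> w; rewrite lee_fin.
- exact: (measurable_fun_fibers (EFin \o h)).
apply: eq_eseriesr => k _; rewrite -integral_cst; last exact: measurable_fiber.
by apply: eq_integral => w; rewrite inE => <-; rewrite pickleK.
Qed.

End countable_fibers.

Lemma measurable_map_fibers d (T : measurableType d) (I V : eqType) (s : seq I)
    (X : I -> T -> V) v :
  (forall i n, measurable [set w | X i w = n]) ->
  measurable [set w | [seq X i w | i <- s] = v].
Proof.
move=> mX; elim: s v => [|i s ih] [|n v] /=.
- by rewrite (_ : [set _ | _] = setT)//; apply/seteqP; split.
- by rewrite (_ : [set _ | _] = set0)//; apply/seteqP; split.
- by rewrite (_ : [set _ | _] = set0)//; apply/seteqP; split.
- rewrite (_ : [set _ | _] = [set w | X i w = n] `&` [set w | [seq X i w | i <- s] = v]).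
    by apply: measurableI => //; exact: ih.
  by apply/seteqP; split=> [w /= [<- <-]//|w /= [<- <-]].
Qed.

Section coordinates.
Context {L : countType}.
Implicit Types (D : seq L) (x y : config L).

Definition depends_on (U : Type) D (f : config L -> U) :=
  forall x y, {in D, x =1 y} -> f x = f y.

Lemma eq_particle_list D x y : {in D, x =1 y} -> particle_list D x = particle_list D y.
Proof. by move=> xy; congr flatten; apply/eq_in_map => i iD; rewrite xy. Qed.

Lemma depends_on_particle_list (U : Type) D (f : seq L -> U) :
  depends_on D (fun x => f (particle_list D x)).
Proof. by move=> x y /eq_particle_list ->. Qed.

(** These lists form a countable type, so any function of finitely many coordinates factors through
    countably many values and is automatically measurable. *)
Definition coords D x : seq nat := [seq x i | i <- D].

Lemma depends_onP U D (f : config L -> U) : depends_on D f ->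
  exists h, forall x, f x = h (coords D x).
Proof.
move=> fD; exists (fun v => f (xget (fun=> 0%N) [set y | coords D y = v])) => x.
case: xgetP => [y _ yx|/(_ x)/(_ erefl)//].
apply: fD => i iD; have := congr1 (nth 0%N ^~ (index i D)) yx.
by rewrite /coords !(nth_map i) ?index_mem// nth_index.
Qed.

Lemma measurable_coordinate i n : measurable [set x : config L | x i = n].
Proof. by apply: sub_sigma_algebra; exists i, n. Qed.

Lemma measurable_coords D v : measurable [set x : config L | coords D x = v].
Proof.
exact: (@measurable_map_fibers _ (config L) _ _ D (fun i x => x i) v measurable_coordinate).
Qed.

Lemma measurable_depends_on d (U : measurableType d) D (f : config L -> U) :
  depends_on D f -> measurable_fun [set: config L] f.
Proof.
move=> /depends_onP[h fh]; rewrite (_ : f = h \o coords D).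
  exact: measurable_fun_fibers (measurable_coords D) _ _ h.
exact/funext.
Qed.

End coordinates.

(** * From independent marks to the thinning operator *)

Section thinning.
Context {R : realType} {L : countType} {d : measure_display} {S : measurableType d}.
Variables (r : R) (Q : probability S R).
Variables (Y : {RV Q >-> config L}) (keep : L -> nat -> {RV Q >-> bool}).
Hypothesis r01 : 0 <= r <= 1.
Hypothesis indep : forall (B : set (config L)) (J : seq (L * nat)) (e : L * nat -> bool),
  measurable B -> uniq J ->
  Q (Y @^-1` B `&` [set w | forall m, m \in J -> keep m.1 m.2 w = e m])
  = (Q (Y @^-1` B) * (\prod_(m <- J) (if e m then r else 1 - r))%:E)%E.

Let kept (J : seq (L * nat)) (w : S) : seq L := [seq m.1 | m <- J & keep m.1 m.2 w].
Let marked (B : set (config L)) (J : seq (L * nat)) (e : L * nat -> bool) : set S :=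
  Y @^-1` B `&` [set w | forall m, m \in J -> keep m.1 m.2 w = e m].

Lemma measurable_keep i n b : measurable [set w | keep i n w = b].
Proof. exact: (@measurable_funPTI _ _ _ _ (keep i n) [set b]). Qed.

Lemma measurable_marked B J e : measurable B -> measurable (marked B J e).
Proof.
move=> mB; apply: measurableI.
  exact: (@measurable_funPTI _ _ _ _ Y B).
elim: J => [|m J ih].
  by rewrite (_ : [set _ | _] = setT)//; apply/seteqP; split.
rewrite (_ : [set _ | _] = [set w | keep m.1 m.2 w = e m] `&`
  [set w | forall m, m \in J -> keep m.1 m.2 w = e m]).
  by apply: measurableI => //; exact: measurable_keep.
apply/seteqP; split=> [w kw|w [/= k1 k2] m' /=].
  by split=> [|m' m'J] /=; apply: kw; rewrite inE ?eqxx// m'J orbT.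
by rewrite inE => /orP[/eqP->//|]; exact: k2.
Qed.

Lemma measurable_kept J (h : config L -> R) :
  measurable_fun [set: S] (fun w => (h (cfg (kept J w)))%:E).
Proof.
have mJ v : measurable [set w | [seq keep m.1 m.2 w | m <- J] = v].
  by apply: (measurable_map_fibers J (X := fun m w => keep m.1 m.2 w)) => m n; exact: measurable_keep.
have := measurable_fun_fibers mJ (fun v => (h (cfg [seq m.1 | m <- mask v J]))%:E).
by apply: eq_measurable_fun => w _; rewrite /= /kept filter_mask.
Qed.

(** The marks in [J0] have been revealed, those in [J1] not yet. Revealing the first mark of [J1]
    splits the event in two, with factors [r] and 1 - r, which is the recursion of [thin_op]. *)
Lemma integral_kept B J0 J1 e (h : config L -> R) :
  measurable B -> uniq (J0 ++ J1) -> (forall s, 0 <= h (cfg s)) ->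
  (\int[Q]_(w in marked B J0 e) (h (cfg (kept J1 w)))%:E =
   Q (Y @^-1` B) * (\prod_(m <- J0) (if e m then r else 1 - r)
     * thin_op r h [seq m.1 | m <- J1])%:E)%E.
Proof.
move=> mB; elim: J1 J0 e h => [|m J1 ih] J0 e h.
  rewrite cats0 => uJ h0 /=.
  rewrite (_ : (fun _ => _) = cst (h (cfg [::]))%:E)//.
  rewrite integral_cst; last exact: measurable_marked.
  rewrite [X in (_ * X)%E](indep e mB uJ).
  by rewrite muleCA -EFinM mulrC.
move=> uJ h0.
(* [e] overridden at [m]; as [m] is not in [J0], the prescriptions there are unaffected. *)
pose eb b (m' : L * nat) := if m' == m then b else e m'.
have mJ0 : m \notin J0.
  by move: uJ; rewrite cat_uniq /= negb_or => /and3P[_ /andP[]].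
have ebJ0 b m' : m' \in J0 -> eb b m' = e m'.
  by rewrite /eb; case: eqVneq => // ->; rewrite (negPf mJ0).
have uJ' : uniq ((m :: J0) ++ J1).
  by move: uJ; rewrite -cat1s uniq_catCA.
have split_set : marked B J0 e = marked B (m :: J0) (eb true) `|` marked B (m :: J0) (eb false).
  apply/seteqP; split=> [w [Bw kw]|w].
    have kb b : keep m.1 m.2 w = b -> marked B (m :: J0) (eb b) w.
      move=> kmb; split=> // m'; rewrite inE => /orP[/eqP->|m'J].
        by rewrite /eb eqxx.
      by rewrite ebJ0// kw.
    by case km : (keep m.1 m.2 w); [left|right]; exact: kb.
  by case=> -[Bw kw]; split=> // m' m'J; rewrite kw ?ebJ0// inE m'J orbT.
have km b w : marked B (m :: J0) (eb b) w -> keep m.1 m.2 w = b.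
  by case=> _ /(_ m (mem_head _ _)); rewrite /eb eqxx.
rewrite split_set ge0_integral_setU//=; first last.
- apply/eqP/seteqP; split=> // w [/km k1 /km k2].
  by rewrite k1 in k2.
- by move=> w _; rewrite lee_fin.
- by apply: (measurable_funS measurableT) => //; exact: measurable_kept.
- exact: measurable_marked.
- exact: measurable_marked.
rewrite (eq_integral (fun w => (h (add1 (cfg (kept J1 w)) m.1))%:E)); last first.
  by move=> w; rewrite inE => /km kmw; rewrite /kept /= kmw /= add1_cfg.
rewrite [X in (_ + X)%E](eq_integral (fun w => (h (cfg (kept J1 w)))%:E)); last first.
  by move=> w; rewrite inE => /km kmw; rewrite /kept /= kmw.
rewrite (ih _ _ (fun x => h (add1 x m.1)))//; last first.
  by move=> s; rewrite add1_cfg.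
rewrite ih// !big_cons /eb eqxx.
have prodE b : \prod_(j <- J0) (if eb b j then r else 1 - r) =
    \prod_(j <- J0) (if e j then r else 1 - r).
  by rewrite big_seq [RHS]big_seq; apply: eq_bigr => m' m'J; rewrite ebJ0.
rewrite !prodE -muleDr//; last by apply: fin_num_measure; exact: (@measurable_funPTI _ _ _ _ Y B).
by rewrite -EFinD; congr (_ * _%:E)%E; ring.
Qed.

Let marks (D : seq L) (y : config L) : seq (L * nat) :=
  flatten [seq [seq (i, n) | n <- iota 0 (y i)] | i <- D].

Let mem_marks D y i n : ((i, n) \in marks D y) = (i \in D) && (n < y i)%N.
Proof.
apply/flatten_mapP/andP => [[j jD /mapP[k + [-> ->]]]|[iD ni]].
  by rewrite mem_iota.
by exists i => //; apply: map_f; rewrite mem_iota.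
Qed.

Let uniq_marks D y : uniq D -> uniq (marks D y).
Proof.
elim: D => [//|i D ih] /= /andP[iD uD]; rewrite /marks /= cat_uniq ih// andbT.
rewrite map_inj_uniq ?iota_uniq => [|n n' []]//=.
apply/hasPn => -[j n]; rewrite -/(marks D y) mem_marks => /andP[jD _].
by apply/mapP => -[n' _ [ji _]]; rewrite -ji jD in iD.
Qed.

Let map_fst_marks D y : [seq m.1 | m <- marks D y] = particle_list D y.
Proof.
rewrite /marks /particle_list map_flatten -map_comp; congr flatten.
apply: eq_map => i /=; rewrite -map_comp /=.
by elim: (y i) 0%N => [//|n ih] k /=; rewrite ih.
Qed.

Variable Z : {RV Q >-> config L}.
Hypothesis ZE : forall w i, Z w i = (\sum_(n < Y w i) keep i n w)%N.

Let kept_marks D y w : uniq D -> {in D, Y w =1 y} ->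
  cfg (kept (marks D y) w) = cfg (particle_list D (Z w)).
Proof.
move=> uD Yy; apply/funext => k; rewrite /cfg count_particle_list//.
have countE i s : count_mem k [seq m.1 | m <- [seq (i, n) | n <- s] & keep m.1 m.2 w] =
    if k == i then (\sum_(n <- s) keep i n w)%N else 0%N.
  elim: s => [|n s ih]; first by rewrite /= big_nil if_same.
  rewrite /= big_cons; case: (keep i n w) => /=; rewrite ih; last by [].
  by have [_|_] := eqVneq k i.
transitivity (if k \in D then (\sum_(n <- iota 0 (y k)) keep k n w)%N else 0%N).
  rewrite /kept /marks {Yy}; elim: D uD => [//|i D ih] /= /andP[iD uD].
  rewrite filter_cat map_cat count_cat countE ih// inE.
  by have [->|ki] := eqVneq k i; rewrite //= (negPf iD) addn0.
case: ifP => // kD; rewrite ZE (Yy _ kD) -(big_mkord predT (fun n => keep k n w : nat)).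
by rewrite /index_iota subn0.
Qed.

(** Where the coordinates of [Y] on [D] are fixed, the list of relevant marks is fixed too, and
    [integral_kept] applies with no mark revealed; the countably many pieces are then added up. *)
Lemma integral_thinning D (h : config L -> R) : uniq D -> (forall s, 0 <= h (cfg s)) ->
  (\int[Q]_w (h (cfg (particle_list D (Z w))))%:E =
   \int[Q]_w (thin_op r h (particle_list D (Y w)))%:E)%E.
Proof.
move=> uD h0.
have thin0 s : 0 <= thin_op r h s.
  by rewrite -(@thin_op_cst _ _ r 0 s); exact: le_thin_op.
have coordsE x y : coords D x = coords D y -> {in D, x =1 y}.
  move=> xy i iD; have := congr1 (nth 0%N ^~ (index i D)) xy.
  by rewrite /coords !(nth_map i) ?index_mem// nth_index.
have mY v : measurable [set w | coords D (Y w) = v].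
  exact: (@measurable_funPTI _ _ _ _ Y _ (measurable_coords D v)).
have meas (W : {RV Q >-> config L}) (f : seq L -> R) :
    measurable_fun [set: S] (fun w => (f (particle_list D (W w)))%:E).
  have := @measurable_depends_on L _ _ D _ (depends_on_particle_list (fun s => (f s)%:E)).
  by move=> /measurableT_comp; apply; exact: measurable_funPT.
rewrite (integral_fibers mY); last 2 first.
- by move=> w; rewrite lee_fin.
- exact: (meas Z (fun s => h (cfg s))).
rewrite (integral_fibers mY); last 2 first.
- by move=> w; rewrite lee_fin.
- exact: (meas Y (fun s => thin_op r h s)).
apply: eq_eseriesr => k _.
have [->|/set0P[w0 w0k]] := eqVneq (fiber (fun w => coords D (Y w)) k) set0.
  by rewrite !integral_set0.
set y := Y w0.
have Yy w : fiber (fun w => coords D (Y w)) k w -> {in D, Y w =1 y}.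
  move=> wk; apply: coordsE; apply: (pcan_inj pickleK).
  by rewrite wk w0k.
have fiberE : fiber (fun w => coords D (Y w)) k =
    marked [set x | coords D x = coords D y] [::] (fun=> true).
  apply/seteqP; split=> [w wk|w [/= wy _]]; last by rewrite /fiber /= wy.
  split=> //=; apply: (pcan_inj pickleK).
  by rewrite wk w0k.
rewrite (eq_integral (fun w => (h (cfg (kept (marks D y) w)))%:E)); last first.
  by move=> w; rewrite inE => /Yy wy; rewrite (kept_marks uD wy).
rewrite [RHS](eq_integral (cst (thin_op r h (particle_list D y))%:E)); last first.
  by move=> w; rewrite inE => /Yy wy; rewrite (eq_particle_list wy).
rewrite integral_cst; last exact: measurable_fiber.
rewrite fiberE integral_kept//; last 2 first.
- exact: measurable_coords.
- exact: uniq_marks.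
rewrite big_nil mul1r map_fst_marks muleC; congr (_ * Q _)%E.
by apply/seteqP; split=> [w wy|w []//].
Qed.

End thinning.

(** * From finite to infinite configurations *)
Section exhaustion.
Context {R : realType} {L : countType}.
Implicit Types (gamma : L -> R) (x y : config L) (i j : L).

(** An increasing exhaustion of the lattice by codes below [n]; [undup] guards against two codes
    that decode to the same site. *)
Definition sites (n : nat) : seq L := undup (pmap unpickle (iota 0 n)).

Lemma mem_sites i n : (pickle i < n)%N -> i \in sites n.
Proof.
move=> ni; rewrite mem_undup mem_pmap; apply/mapP; exists (pickle i).
  by rewrite mem_iota.
by rewrite pickleK.
Qed.

Lemma sub_sites (s : seq L) : exists n, forall m, (n <= m)%N -> {subset s <= sites m}.
Proof.
exists (\max_(i <- s) pickle i).+1 => m nm i si; apply: mem_sites.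
by apply: leq_trans nm; rewrite ltnS; exact: leq_bigmax_seq.
Qed.

Definition restrict_sites (n : nat) x : config L := cfg (particle_list (sites n) x).

Lemma restrict_sitesE n x i : restrict_sites n x i = if i \in sites n then x i else 0%N.
Proof. by rewrite /restrict_sites /cfg count_particle_list// undup_uniq. Qed.

Section weights.
Variable gamma : L -> R.
Hypothesis gamma0 : forall i, 0 < gamma i.

Let weight x i : R := gamma i * (x i)%:R.

Let weight0 x i : 0 <= weight x i.
Proof. by rewrite mulr_ge0// ltW. Qed.

Let wnormE x : wnorm gamma (particles x) = \esum_(i in [set: L]) (weight x i)%:E.
Proof. by apply: eq_esum => i _; rewrite /particles normr_nat. Qed.

Lemma Egamma_cfg s : Egamma gamma (cfg s).
Proof.
rewrite /Egamma /= wnormE; apply: abs_summable_ge0 => //.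
by apply: (@abs_summable_finite _ _ _ _ s) => i _ /count_memPn si; rewrite /weight /cfg si mulr0.
Qed.

Lemma gdist_restrict_lt x (e : R) : Egamma gamma x -> 0 < e ->
  exists n, forall m, (n <= m)%N -> (gdist gamma (restrict_sites m x) x < e%:E)%E.
Proof.
rewrite /Egamma /= wnormE => xfin.
have xsum : abs_summable [set: L] (weight x) by exact: ge0_abs_summable.
have gdistE n : gdist gamma (restrict_sites n x) x =
    (asum [set: L] (fun i => weight x i * (i \notin sites n)%:R))%:E.
  rewrite ge0_asumE.
  - apply: eq_esum => i _; rewrite /particles restrict_sitesE; congr EFin.
    case: ifP => _ /=; first by rewrite subrr normr0 !mulr0.
    by rewrite sub0r normrN normr_nat mulr1.
  - by move=> i _; rewrite mulr_ge0.
  - apply: le_lt_trans xfin; apply: le_esum => i _; rewrite lee_fin.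
    by case: (i \notin _); rewrite ?mulr1// mulr0.
move=> e0; have [s hs] := abs_summable_tail (fun i _ => weight0 x i) xsum e0.
have [n hn] := sub_sites s; exists n => m nm; rewrite gdistE lte_fin.
have tail (t : seq L) : abs_summable [set: L] (fun i => weight x i * (i \notin t)%:R).
  apply: le_abs_summable xsum => i _; rewrite normrM ler_piMr//.
  by rewrite normr_nat; case: (i \notin t).
apply: le_lt_trans hs; apply: le_asum => // i _; rewrite ler_wpM2l// ler_nat.
by case: (boolP (i \in s)) => [/(hn m nm)->//|_]; case: (i \notin _).
Qed.

Lemma lipschitz_cvg (g : config L -> R) x : lipschitz_Egamma gamma g ->
  Egamma gamma x -> g (restrict_sites n x) @[n --> \oo] --> g x.
Proof.
move=> [C gC] xE; apply/cvgrPdist_lt => e e0.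
(* The Lipschitz constant supplied may be zero or negative. *)
pose C' := Num.max C 1; have C'0 : 0 < C' by rewrite lt_max ltr01 orbT.
have [n hn] := gdist_restrict_lt xE (divr_gt0 e0 C'0).
exists n => // m /= nm; rewrite distrC -lte_fin.
have gm0 : (0 <= gdist gamma (restrict_sites m x) x)%E.
  by apply: esum_ge0 => i _; rewrite lee_fin mulr_ge0// ltW.
apply: le_lt_trans (gC _ _ (Egamma_cfg _) xE) _.
apply: (@le_lt_trans _ _ (C'%:E * gdist gamma (restrict_sites m x) x)%E).
  by apply: lee_wpmul2r => //; rewrite lee_fin le_max lexx.
have := hn m nm; move: gm0; case: (gdist _ _ _) => [u| |]//= u0.
by rewrite -EFinM !lte_fin ltr_pdivlMr// mulrC.
Qed.

(** Occupation numbers are integers: if f(x) and f(y) differ, some coordinate i in [D] differs by at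
    least 1, so the distance is at least gamma_i, while |f(x) - f(y)| <= 1. *)
Lemma lipschitz_depends_on D (f : config L -> R) :
  depends_on D f -> (forall x, 0 <= f x <= 1) -> lipschitz_Egamma gamma f.
Proof.
move=> fD f01; exists (\sum_(i <- D) (gamma i)^-1) => x y _ _.
have C0 : 0 <= \sum_(i <- D) (gamma i)^-1.
  by apply: sumr_ge0 => i _; rewrite invr_ge0 ltW.
have gdist0 : (0 <= gdist gamma x y)%E.
  by apply: esum_ge0 => i _; rewrite lee_fin mulr_ge0// ltW.
have [xy|nxy] := pselect {in D, x =1 y}.
  by rewrite (fD _ _ xy) subrr normr0 mule_ge0.
have [i iD xyi] : exists2 i, i \in D & x i != y i.
  apply: contra_notP nxy => nex i iD; apply/eqP.
  by apply: contra_notT nex => xyi; exists i.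
have f1 : `|f x - f y| <= 1.
  by have /andP[? ?] := f01 x; have /andP[? ?] := f01 y; rewrite ler_distl; apply/andP; split; lra.
have dist1 : 1 <= `|(x i)%:R - (y i)%:R| :> R.
  wlog xy : x y {nxy f1 gdist0} xyi / (x i < y i)%N.
    move=> H; move: xyi; rewrite neq_ltn => /orP[lt|lt]; first by apply: H => //; rewrite neq_ltn lt.
    by rewrite distrC; apply: H => //; rewrite neq_ltn lt.
  rewrite distrC ger0_norm ?subr_ge0 ?ler_nat 1?ltnW//.
  by rewrite lerBrDr nat1r ler_nat.
apply: (@le_trans _ _ 1%:E); first by rewrite lee_fin.
have gi : ((gamma i)%:E <= gdist gamma x y)%E.
  apply: (@le_trans _ _ (\esum_(j in [set i])
      (gamma j * `|particles x j - particles y j|)%:E)).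
    rewrite esum_set1; last by rewrite lee_fin mulr_ge0// ltW.
    by rewrite lee_fin ler_peMr// ltW.
  rewrite [leLHS]esum_mkcond; apply: le_esum => j _.
  by case: ifP => // _; rewrite lee_fin mulr_ge0// ltW.
have Ci : (gamma i)^-1 <= \sum_(i <- D) (gamma i)^-1.
  by rewrite (big_rem i)//= lerDl; apply: sumr_ge0 => j _; rewrite invr_ge0 ltW.
apply: (@le_trans _ _ ((gamma i)^-1%:E * (gamma i)%:E)%E).
  by rewrite -EFinM mulVf// gt_eqF.
apply: lee_pmul => //; rewrite lee_fin ?invr_ge0 ltW//.
Qed.

(** A finite norm means that the partial sums over [sites n] stay below some integer, a countable
    combination of events on finitely many coordinates. *)
Lemma measurable_Egamma : measurable (Egamma gamma : set (config L)).
Proof.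
pose W n N x := \sum_(i <- sites n) weight x i <= N%:R.
have sum_le x n : abs_summable [set: L] (weight x) ->
    \sum_(i <- sites n) weight x i <= asum [set: L] (weight x).
  by move=> xs; apply: ge0_asum_ge_finite => //; exact: undup_uniq.
have -> : Egamma gamma = \bigcup_N \bigcap_n [set x | W n N x].
  apply/seteqP; split=> [x|x [N _ xN]]; rewrite /Egamma /= wnormE.
    move=> xfin; exists (Num.trunc (asum [set: L] (weight x))).+1 => // n _ /=.
    rewrite /W (le_trans (sum_le _ _ _)) ?ltW ?truncnS_gt//.
    exact: ge0_abs_summable.
  apply: (@le_lt_trans _ _ N%:R%:E); last exact: ltry.
  apply: ge_ereal_sup => _ [A [finA _] <-].
  pose s : seq L := finmap.enum_fset (fset_set A).
  have [n hn] := sub_sites s; have := xN n I; rewrite /= /W.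
  rewrite fsbig_finite//= sumEFin lee_fin; apply: le_trans.
  have us : uniq s by exact: finmap.fset_uniq.
  have ps : perm_eq [seq i <- sites n | i \in s] s.
    apply: uniq_perm => //; first by rewrite filter_uniq// undup_uniq.
    move=> i; rewrite mem_filter; case: (boolP (i \in s)) => // si.
    by rewrite (hn n (leqnn n) i si).
  rewrite [leRHS](bigID (mem s))/= -[X in X + _]big_filter (perm_big _ ps)/=.
  by rewrite lerDl sumr_ge0.
apply: bigcupT_measurable => N; apply: bigcapT_measurable => n.
have WD : depends_on (sites n) (W n N).
  move=> x y xy; rewrite /W big_seq [in RHS]big_seq; congr (_ <= _).
  by apply: eq_bigr => i iD; rewrite /weight xy.
have := measurable_depends_on WD measurableT (Y := [set true]).
by rewrite setTI; apply.
Qed.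

End weights.
End exhaustion.

(** * Approximation of the process by its restricted initial states *)

Section process_limit.
Context {R : realType} {L : countType}.
Variables (q : L -> L -> R) (gamma : L -> R) (a b c d : R).
Hypothesis gamma0 : forall i, 0 < gamma i.
Context {dO : measure_display} {O : measurableType dO} (P : probability O R).
Variable X : R -> {RV P >-> config L}.

Let mX (t : R) : measurable_fun [set: O] (X t).
Proof. exact: measurable_funPT. Qed.

Lemma markov_integral k (t : R) D (f : config L -> R) : markov_process k X ->
  0 <= t -> depends_on D f -> (forall x, 0 <= f x) ->
  (\int[P]_w (f (X t w))%:E = \int[P]_w \int[k t (X 0 w)]_y (f y)%:E)%E.
Proof.
move=> markov t0 fD f0; have [h0 fh0] := depends_onP fD.
(* Off the range of [coords D] the sign of [h0] is unknown, hence the absolute value. *)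
pose h v := `|h0 v|; have h_ge0 v : 0 <= h v by exact: normr_ge0.
have fh x : f x = h (coords D x) by rewrite /h -fh0 ger0_norm.
pose C := fiber (fun x : config L => coords D x).
have mC j : measurable (C j) by exact: measurable_fiber (measurable_coords D) j.
pose co (j : nat) : \bar R := (oapp h 0 (unpickle j))%:E.
have co0 j : (0 <= co j)%E by rewrite lee_fin; case: (unpickle j).
have mfib v : measurable [set w | coords D (X t w) = v].
  exact: (@measurable_funPTI _ _ _ _ (X t) _ (measurable_coords D v)).
transitivity (\sum_(j <oo) co j * P (X t @^-1` C j))%E.
  under eq_integral do rewrite fh.
  exact: (integral_fibers_comp mfib P h_ge0).
have mk j : measurable_fun [set: O] (fun w => k t (X 0 w) (C j)).
  exact: measurableT_comp (measurable_kernel (k t) _ (mC j)) (mX 0).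
transitivity (\sum_(j <oo) \int[P]_w (co j * k t (X 0 w) (C j)))%E.
  apply: eq_eseriesr => j _; rewrite ge0_integralZl//; congr (_ * _)%E.
  have pT : past X 0 [set: O].
    exact: (@measurableT _ (g_sigma_algebraType [set A | exists (u : R) (B : set (config L)),
      [/\ 0 <= u <= 0, measurable B & A = X u @^-1` B]])).
  by have := markov 0 t [set: O] (C j) (lexx 0) t0 pT (mC j); rewrite setTI add0r.
rewrite -integral_nneseries//; last 2 first.
- by move=> j; exact: measurable_funeM.
- by move=> j w _; rewrite mule_ge0.
apply: eq_integral => w _; under [RHS]eq_integral do rewrite fh.
by rewrite (integral_fibers_comp (measurable_coords D) (k t (X 0 w)) h_ge0).
Qed.

Lemma kernel_integral_Egamma (k : R.-pker config L ~> config L) x (f : config L -> R) :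
  k x (Egamma gamma) = 1%E -> measurable_fun [set: config L] f -> (forall y, 0 <= f y) ->
  (\int[k x]_y (f y)%:E = \int[k x]_(y in Egamma gamma) (f y)%:E)%E.
Proof.
move=> kE mf f0; have mE := measurable_Egamma gamma0.
have kC : k x (~` Egamma gamma) = 0%E.
  have kU : (k x (Egamma gamma `|` ~` Egamma gamma) =
      k x (Egamma gamma) + k x (~` Egamma gamma))%E.
    by apply: measureU => //; [exact: measurableC|rewrite setICr].
  move: kU; rewrite setUv prob_kernel kE.
  case: (k x (~` _)) (measure_ge0 (k x) (~` Egamma gamma)) => [u| |]//= _.
  by rewrite -EFinD => -[e]; congr EFin; lra.
rewrite (@ge0_negligible_integral _ _ _ _ setT (~` Egamma gamma))//.
- by rewrite setTD setCK.
- exact: measurableC.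
- exact/measurable_EFinP.
- by move=> y _; rewrite lee_fin.
Qed.

(** E f(X_t) is the mean of [g] at X_0, where [g] is the Lipschitz extension of P_t f. Restrictions
    of X_0 converge to it in the gamma-norm and all values lie in [0, 1], so dominated convergence
    applies. *)
Lemma process_semigroup_limit : branco_process q gamma a b c d X ->
  exists2 p, branco_chain q a b c d p &
  forall (t : R) D (f : config L -> R), 0 <= t -> depends_on D f ->
    (forall x, 0 <= f x <= 1) ->
    (\int[P]_w (semigroup p t f (restrict_sites n (X 0 w)))%:E)%E @[n --> \oo] -->
    (\int[P]_w (f (X t w))%:E)%E.
Proof.
move=> [cadlag [k [p hp kernel] markov]]; exists p => // t D f t0 fD f01.
have f0 x : 0 <= f x by have /andP[] := f01 x.
have mf : measurable_fun [set: config L] f by exact: measurable_depends_on fD.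
rewrite (markov_integral markov t0 fD f0).
have [kE lip] := kernel t t0.
have [g [gL gE] gint] := lip f (lipschitz_depends_on gamma0 fD f01).
have f01' : unit_on_fin f by move=> s; exact: f01.
pose u (n : nat) (w : O) : \bar R := (semigroup p t f (restrict_sites n (X 0 w)))%:E.
have mu_ n : measurable_fun [set: O] (u n).
  have := @measurable_depends_on L _ _ (sites n) _
    (depends_on_particle_list (fun s => (semigroup p t f (cfg s))%:E)).
  by move=> /measurableT_comp; apply; exact: mX.
have mlim : measurable_fun [set: O] (fun w => \int[k t (X 0 w)]_y (f y)%:E)%E.
  have := @measurable_fun_integral_kernel _ _ _ _ _ (k t) (measurable_kernel (k t))
    (fun y => (f y)%:E) (fun y => f0 y).
  have mEf : measurable_fun [set: config L] (fun y => (f y)%:E) by exact/measurable_EFinP.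
  by move=> /(_ mEf) /measurableT_comp; apply; exact: mX.
have [] := @dominated_convergence _ _ _ P setT measurableT u
  (fun w => \int[k t (X 0 w)]_y (f y)%:E)%E (cst 1%E) mu_ mlim.
(* The path condition at time 0 says that X_0 lies in [Egamma gamma] almost surely. *)
- apply: filterS cadlag => w [/(_ 0 (lexx 0)) XE _ _] _.
  rewrite (kernel_integral_Egamma (kE _ XE) mf f0) (gint _ XE).2.
  apply: cvg_EFin; first by apply: nearW.
  apply: cvg_trans (lipschitz_cvg gamma0 gL XE).
  by apply: near_eq_cvg; apply: nearW => n /=; rewrite gE//; exact: fin_cfg.
- exact: finite_measure_integrable_cst.
- apply: aeW => w n _; rewrite /= lee_fin.
  have /andP[s0 s1] := semigroup_unit hp t0 f01' (particle_list (sites n) (X 0 w)).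
  by rewrite ger0_norm.
- by move=> _ _; apply.
Qed.

End process_limit.

Section cylinders.
Context {L : countType}.

Definition cylinder (J : seq (L * nat)) : set (config L) :=
  [set x | all (fun m => x m.1 == m.2) J].

Lemma cylinder_cat J J' : cylinder (J ++ J') = cylinder J `&` cylinder J'.
Proof.
by apply/seteqP; split=> x; rewrite /cylinder /= all_cat => /andP.
Qed.

Lemma measurable_cylinder J : measurable (cylinder J).
Proof.
elim: J => [|m J ih]; first by rewrite (_ : cylinder [::] = setT)//; apply/seteqP; split.
rewrite -cat1s cylinder_cat; apply: measurableI => //.
rewrite (_ : cylinder [:: m] = [set x | x m.1 = m.2]); first exact: measurable_coordinate.
by apply/seteqP; split=> x; rewrite /cylinder /= andbT => /eqP.
Qed.

Lemma measurable_cylinderE :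
  @measurable _ (config L) = <<s [set cylinder J | J in [set: seq (L * nat)]] >>.
Proof.
apply/seteqP; split; last first.
  apply: smallest_sub; first exact: sigma_algebra_measurable.
  by move=> _ [J _ <-]; exact: measurable_cylinder.
apply: smallest_sub; first exact: smallest_sigma_algebra.
move=> _ [i [n ->]]; apply: sub_sigma_algebra; exists [:: (i, n)] => //.
by apply/seteqP; split=> x; rewrite /cylinder /= andbT => /eqP.
Qed.

(** Cylinders form a generating pi-system (intersection is concatenation of the constraints) that
    contains the whole space as [cylinder [::]]. *)
Lemma same_law_cylinder (R : realType) d1 d2 (O1 : measurableType d1)
    (O2 : measurableType d2) (P1 : probability O1 R) (P2 : probability O2 R)
    (X1 : {RV P1 >-> config L}) (X2 : {RV P2 >-> config L}) :
  (forall J, distribution P1 X1 (cylinder J) = distribution P2 X2 (cylinder J)) ->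
  same_law X1 X2.
Proof.
move=> eqJ A mA.
apply: (measure_unique _ (fun=> cylinder [::]) measurable_cylinderE) => //.
- by move=> _ _ [J _ <-] [J' _ <-]; exists (J ++ J') => //; rewrite cylinder_cat.
- by apply/seteqP; split=> // x _; exists 0%N.
- by move=> _ [J _ <-]; exact: eqJ.
- by move=> _; rewrite (le_lt_trans (probability_le1 _ (measurable_cylinder _))) ?ltry.
Qed.

Lemma same_law_integral (R : realType) d1 d2 (O1 : measurableType d1)
    (O2 : measurableType d2) (P1 : probability O1 R) (P2 : probability O2 R)
    (X1 : {RV P1 >-> config L}) (X2 : {RV P2 >-> config L})
    D (f : config L -> R) :
  same_law X1 X2 -> depends_on D f -> (forall x, 0 <= f x) ->
  (\int[P1]_w (f (X1 w))%:E = \int[P2]_w (f (X2 w))%:E)%E.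
Proof.
move=> law fD f0.
have mf : measurable_fun [set: config L] (fun x => (f x)%:E).
  by apply/measurable_EFinP; exact: measurable_depends_on fD.
rewrite -(ge0_integral_distribution X1 mf) => [|x]; last by rewrite lee_fin.
rewrite -(ge0_integral_distribution X2 mf) => [|x]; last by rewrite lee_fin.
by apply: eq_measure_integral => A mA _; exact: law.
Qed.

End cylinders.

Section thinned.
Context {R : realType} {L : countType} (r : R).
Hypothesis r01 : 0 <= r <= 1.

Lemma is_thinning_integral dO dS (O : measurableType dO) (S : measurableType dS)
    (P : probability O R) (Y : {RV P >-> config L}) (Q : probability S R)
    (Z : {RV Q >-> config L}) (D : seq L) (h : config L -> R) :
  is_thinning r Y Z -> uniq D -> (forall s, 0 <= h (cfg s)) ->
  (\int[Q]_w (h (cfg (particle_list D (Z w))))%:E =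
   \int[P]_w (thin_op r h (particle_list D (Y w)))%:E)%E.
Proof.
move=> [Y' [keep [law indep ZE]]] uD h0.
rewrite (integral_thinning r01 indep ZE uD h0).
apply: (same_law_integral law (f := fun x => thin_op r h (particle_list D x)) (D := D)).
  exact: depends_on_particle_list.
move=> x; rewrite -(@thin_op_cst _ _ r 0 (particle_list D x)).
exact: le_thin_op.
Qed.

End thinned.

Theorem corollary3 (R : realType) (L : countType)
  (q : L -> L -> R) (gamma : L -> R) (a b c d : R)
  (hq : jump_rates q) (hgamma : site_weights q gamma)
  (ha : 0 <= a) (hb : 0 <= b) (hc : 0 <= c) (hd : 0 <= d) (hac : 0 < a + c)
  (alpha : R) (halpha : alpha = a / (a + c))
  (d1 d2 : measure_display)
  (O1 : measurableType d1) (P1 : probability O1 R)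
  (O2 : measurableType d2) (P2 : probability O2 R)
  (X : R -> {RV P1 >-> config L}) (Xbar : R -> {RV P2 >-> config L})
  (hX : branco_process q gamma a b c d X)
  (hXbar : branco_process q gamma
             0 ((1 + alpha) * b) (a + c) (alpha * b + d) Xbar)
  (e0 : measure_display) (S0 : measurableType e0) (Q0 : probability S0 R)
  (Z0 : {RV Q0 >-> config L})
  (hZ0 : is_thinning (1 / (1 + alpha)) (Xbar 0) Z0)
  (hlaw0 : same_law (X 0) Z0)
  (t : R) (ht : 0 <= t)
  (et : measure_display) (St : measurableType et) (Qt : probability St R)
  (Zt : {RV Qt >-> config L})
  (hZt : is_thinning (1 / (1 + alpha)) (Xbar t) Zt) :
  same_law (X t) Zt.
Proof.
have gamma0 i : 0 < gamma i by case: hgamma.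
have alpha0 : 0 <= alpha by rewrite halpha divr_ge0// ltW.
have aE : a = alpha * (a + c) by rewrite halpha divfK// gt_eqF.
have r01 := thin_rate01 alpha0.
set r := 1 / (1 + alpha) in hZ0 hZt r01.
have [p hp limX] := process_semigroup_limit gamma0 hX.
have [pbar hpbar limXbar] := process_semigroup_limit gamma0 hXbar.
apply: same_law_cylinder => J; pose D := undup [seq m.1 | m <- J].
pose f : config L -> R := \1_(cylinder J).
have f01 x : 0 <= f x <= 1.
  by rewrite /f indicE; case: (_ \in _); rewrite ?ler01 ?lexx.
have fD : depends_on D f.
  move=> x y xy; rewrite /f !indicE; congr ((_ : bool)%:R).
  rewrite /cylinder; apply/idP/idP; rewrite !inE /= => /allP xJ; apply/allP => m mJ.
    by rewrite -xy ?xJ// mem_undup map_f.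
  by rewrite xy ?xJ// mem_undup map_f.
have uD : uniq D by exact: undup_uniq.
have f01' : unit_on_fin f by move=> s; exact: f01.
(* A version of K f that makes sense at infinite configurations: [f] sees only the sites in [D], so
   only particles there need thinning. *)
pose fbar x := thin_op r f (particle_list D x).
have fbarD : depends_on D fbar by exact: depends_on_particle_list.
have fbar01 x : 0 <= fbar x <= 1 by exact: unit_thin_op.
have probE d' (O : measurableType d') (P : probability O R) (W : {RV P >-> config L}) :
    distribution P W (cylinder J) = (\int[P]_w (f (W w))%:E)%E.
  have mW : measurable (W @^-1` cylinder J).
    exact: (@measurable_funPTI _ _ _ _ W _ (measurable_cylinder J)).
  transitivity (P ((W @^-1` cylinder J) `&` setT)); first by rewrite setIT.
  by rewrite -integral_indic.
have fbar_cfg s : fbar (cfg s) = thin_fun r f (cfg s).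
  rewrite thin_fun_cfg (@thin_op_cfg _ _ r f (mem D)) => [|i s' iD].
    apply: thin_op_perm; apply: cfg_inj_perm; apply/funext => i.
    rewrite /cfg count_particle_list// count_filter.
    have [iD|iD] := boolP (i \in D).
      by apply: eq_count => j /=; case: eqVneq => // ->.
    rewrite (eq_count (a2 := pred0)) ?count_pred0// => j /=.
    by case: eqVneq => // ->; exact/negbTE.
  apply: fD => j jD; rewrite /cfg /=.
  by case: eqVneq => // ij; rewrite ij jD in iD.
(* The hypothesis on the initial laws enters here: the restriction of X_0 has the law of the thinned
   restriction of Xbar_0, and [semigroup_thin] applies to the finite restricted state. *)
have lim_eq n : (\int[P1]_w (semigroup p t f (restrict_sites n (X 0 w)))%:E =
    \int[P2]_w (semigroup pbar t fbar (restrict_sites n (Xbar 0 w)))%:E)%E.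
  have pf01 := semigroup_unit hp ht f01'.
  rewrite (same_law_integral hlaw0 (D := sites n)
    (f := fun x => semigroup p t f (restrict_sites n x))); last 2 first.
  - exact: (depends_on_particle_list (fun s => semigroup p t f (cfg s))).
  - by move=> x; case/andP: (pf01 (particle_list (sites n) x)).
  rewrite (is_thinning_integral r01 hZ0); last 2 first.
  - exact: undup_uniq.
  - by move=> s; case/andP: (pf01 s).
  apply: eq_integral => w _; congr EFin.
  rewrite -(semigroup_thin hq ha hb hc hd alpha0 aE hp hpbar _ f01' ht).
  by apply: eq_asum => y /fin_configP[s ->]; rewrite fbar_cfg.
rewrite !probE.
(* Both sides are limits of the same sequence by [lim_eq]; what then remains is the thinning at time
   [t]. *)
transitivity (\int[P2]_w (fbar (Xbar t w))%:E)%E.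
  have l1 := limX t D f ht fD f01.
  have l2 := limXbar t D fbar ht fbarD fbar01.
  apply: (cvg_unique (@ereal_hausdorff R) l1).
  apply: cvg_trans l2; apply: near_eq_cvg; apply: nearW => n.
  exact: esym (lim_eq n).
rewrite -(is_thinning_integral r01 hZt uD); last by move=> s; case/andP: (f01 (cfg s)).
apply: eq_integral => w _; congr EFin; apply: fD => i iD.
by rewrite /cfg count_particle_list// iD.
Qed.
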